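(* Let $H$ be a finite-dimensional semisimple Hopf algebra over $\mathbb{C}$ with generalized character table $\xi_{ij}=\langle\chi_i,\eta_j\rangle$, and let $m_j=\dim f_jR(H)$. For $x\in R(H)$ let $r_x$ denote right multiplication by $x$, viewed as an operator on the right $R(H)$-module $f_jR(H)$. Then: (i) $|\langle\chi_i,\eta_j\rangle|\le m_j\langle\chi_i,1\rangle$ for all $i,j$; (ii) equality holds in (i) if and only if $r_{\chi_i}$ acts on $f_jR(H)$ as $\alpha_i\,\mathrm{Id}_{f_jR(H)}$ for some $\alpha_i\in\mathbb{C}$ with $|\alpha_i|=\langle\chi_i,1\rangle$; (iii) $\langle\chi_i,\eta_j\rangle=m_j\langle\chi_i,1\rangle$ if and only if $r_{\chi_i}$ acts on $f_jR(H)$ as $\langle\chi_i,1\rangle\,\mathrm{Id}_{f_jR(H)}$.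
   Context: $d=\dim H$. $\Lambda\in H$ is the (two-sided) integral of $H$ and $\lambda\in H^*$ the integral of $H^*$ with $\langle\lambda,\Lambda\rangle=1$. For $h\in H$, $p\in H^*$, $h\leftharpoonup p=\sum\langle p,h_1\rangle h_2$. $\chi_0=\varepsilon,\dots,\chi_{n-1}$ are the irreducible characters of $H$; $R(H)\subset H^*$ is their span. $F_0=\frac1d\lambda,\dots,F_{m-1}$ are the central primitive idempotents of $R(H)$; for each $j$, $f_j\in R(H)$ is a primitive idempotent with $f_jF_j=f_j$ (so $f_jR(H)$ is an irreducible right $R(H)$-module). $\eta_j=\frac{1}{\dim(f_jH^* )}(\Lambda\leftharpoonup dF_j)$. *)

(* Defs.v *)
(* A finite-dimensional Hopf algebra over a field C is encoded
   by its structure constants with respect to a fixed basis e_0..e_{d-1} of H.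
   Elements of H and of H^* are both row vectors 'rV[C]_d: h = sum_k h_k e_k,
   and p in H^* has coordinates p_k = <p, e_k> (dual basis).
   Subspaces are handled with mxalgebra row spaces. *)
From HB Require Import structures.
From mathcomp Require Import all_boot all_order all_algebra.
From mathcomp Require Import complex Rstruct.
From Stdlib Require Rdefinitions.

Set Implicit Arguments.
Unset Strict Implicit.
Unset Printing Implicit Defensive.

Import Order.TTheory GRing.Theory Num.Theory.
Local Open Scope ring_scope.

Notation CC := (complex Rdefinitions.R).

Section Hopf.
Variables (C : numClosedFieldType) (d : nat).

(* Structure constants:
     e_a * e_b   = sum_c hmul a b c e_c
     1_H         = sum_c hunit c e_c
     Delta e_c   = sum_{a,b} hcomul c a b e_a (x) e_b
     eps e_c     = hcounit c
     S e_a       = sum_b hanti a b e_b                                       *)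
Record hopf_data := HopfData {
  hmul : 'I_d -> 'I_d -> 'I_d -> C;
  hunit : 'rV[C]_d;
  hcomul : 'I_d -> 'I_d -> 'I_d -> C;
  hcounit : 'I_d -> C;
  hanti : 'M[C]_d
}.

Variable H : hopf_data.

Definition ebas (k : 'I_d) : 'rV[C]_d := delta_mx 0 k.

Definition mulH (x y : 'rV[C]_d) : 'rV[C]_d :=
  \row_c \sum_a \sum_b x 0 a * y 0 b * hmul H a b c.

Definition antiH (x : 'rV[C]_d) : 'rV[C]_d := x *m hanti H.

Definition pairH (p h : 'rV[C]_d) : C := \sum_k p 0 k * h 0 k.

Definition epsH : 'rV[C]_d := \row_k hcounit H k.

Definition convH (p q : 'rV[C]_d) : 'rV[C]_d :=
  \row_c \sum_a \sum_b hcomul H c a b * p 0 a * q 0 b.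

(* h <- p  =  sum <p, h_1> h_2 *)
Definition harp (h p : 'rV[C]_d) : 'rV[C]_d :=
  \row_b \sum_c \sum_a h 0 c * hcomul H c a b * p 0 a.

(* matrix of the linear map y |-> p y (left convolution by p) on H^*:
   its row b is p e_b^*, so the row space of (A *m lconv p) is p * (rowspace A) *)
Definition lconv (p : 'rV[C]_d) : 'M[C]_d :=
  \matrix_(b, c) convH p (ebas b) 0 c.

Definition lmulmx (a : 'I_d) : 'M[C]_d := \matrix_(b, c) hmul H a b c.

Definition is_hopf : Prop :=
  [/\
      ((forall x y z, mulH (mulH x y) z = mulH x (mulH y z)) /\
       (forall x, mulH (hunit H) x = x /\ mulH x (hunit H) = x)),
      (forall c a b e, \sum_k hcomul H c k e * hcomul H k a b
                     = \sum_k hcomul H c a k * hcomul H k b e),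
      ((forall c b, \sum_a hcounit H a * hcomul H c a b = (c == b)%:R) /\
       (forall c a, \sum_b hcounit H b * hcomul H c a b = (c == a)%:R)),
      [/\ (forall a b x y, \sum_c hmul H a b c * hcomul H c x y
          = \sum_x1 \sum_y1 \sum_x2 \sum_y2
              hcomul H a x1 y1 * hcomul H b x2 y2 * hmul H x1 x2 x * hmul H y1 y2 y),
          (forall x y, \sum_c hunit H 0 c * hcomul H c x y = hunit H 0 x * hunit H 0 y),
          (forall a b, \sum_c hmul H a b c * hcounit H c = hcounit H a * hcounit H b) &
          \sum_c hunit H 0 c * hcounit H c = 1]
    &
      ((forall c, \sum_a \sum_b hcomul H c a b *: mulH (antiH (ebas a)) (ebas b)
                 = hcounit H c *: hunit H) /\
      (forall c, \sum_a \sum_b hcomul H c a b *: mulH (ebas a) (antiH (ebas b))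
                 = hcounit H c *: hunit H))].

Definition left_idealH (I : 'M[C]_d) : Prop :=
  forall a, (I *m lmulmx a <= I)%MS.

(* H is a semisimple algebra: every left ideal has a complementary left ideal
   (the left regular module is completely reducible) *)
Definition semisimpleH : Prop :=
  forall I, left_idealH I ->
    exists J, [/\ left_idealH J, (I :&: J)%MS == 0 & row_full (I + J)%MS].

Definition integralH (L : 'rV[C]_d) : Prop :=
  forall h, mulH h L = pairH epsH h *: L /\ mulH L h = pairH epsH h *: L.

Definition integralHdual (l : 'rV[C]_d) : Prop :=
  forall p, convH p l = pairH p (hunit H) *: l /\ convH l p = pairH p (hunit H) *: l.

(* representation of H of degree n given by rho k = rho(e_k) (left module C^n,
   acting on column vectors) *)
Definition is_rep n (rho : 'I_d -> 'M[C]_n) : Prop :=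
  \sum_k hunit H 0 k *: rho k = 1%:M /\
  forall a b, rho a *m rho b = \sum_c hmul H a b c *: rho c.

(* irreducible: no invariant subspace of the column space C^n other than 0, C^n
   (a subspace W of columns is encoded as the row space of U, W = {u^T};
    rho(h) u^T in W  <->  u *m rho(h)^T in U) *)
Definition irr_rep n (rho : 'I_d -> 'M[C]_n) : Prop :=
  [/\ (0 < n)%N, is_rep rho &
  forall U : 'M[C]_n, (forall k, (U *m (rho k)^T <= U)%MS) ->
    U == 0 \/ row_full U].

Definition irr_char (chi : 'rV[C]_d) : Prop :=
  exists n (rho : 'I_d -> 'M[C]_n), irr_rep rho /\ chi = \row_k \tr (rho k).

Definition is_RH (RH : 'M[C]_d) : Prop :=
  (forall chi, irr_char chi -> (chi <= RH)%MS) /\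
  (forall W : 'M[C]_d, (forall chi, irr_char chi -> (chi <= W)%MS) -> (RH <= W)%MS).

Definition idemH (e : 'rV[C]_d) : Prop := convH e e = e.

Definition central_prim_idem (RH : 'M[C]_d) (F : 'rV[C]_d) : Prop :=
  let central e := forall x, (x <= RH)%MS -> convH e x = convH x e in
  [/\ (F <= RH)%MS, idemH F, F != 0, central F &
      ~ exists F1 F2, [/\ ((F1 <= RH)%MS /\ (F2 <= RH)%MS), idemH F1, idemH F2,
          [/\ central F1, central F2, F1 != 0, F2 != 0 & convH F1 F2 = 0] &
          F = F1 + F2]].

Definition prim_idem (RH : 'M[C]_d) (f : 'rV[C]_d) : Prop :=
  [/\ (f <= RH)%MS, idemH f, f != 0 &
      ~ exists e1 e2, [/\ ((e1 <= RH)%MS /\ (e2 <= RH)%MS), idemH e1, idemH e2,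
          [/\ e1 != 0, e2 != 0, convH e1 e2 = 0 & convH e2 e1 = 0] &
          f = e1 + e2]].

End Hopf.

(* Main.v *)
(* First S^2 = id (Larson-Radford): the integrals give S^4 = id and
   Tr(l_p S^2) = <lambda,1> <p,Lambda> on H^*, and this at p = eps and at p = the
   regular character divided by d shows that Tr(S^2) / d is a nonzero integer, so
   S^2 = 1 or -1.  Hence <p,Lambda> = Tr(l_p) / d.  R(H) is the algebra of all
   trace functions on H and this form is nondegenerate on it; so f R(H) f = C f,
   and for dual bases u_k of f R(H) and v_k of R(H) f the sum of the v_k u_k is a
   central idempotent, equal to F.  Therefore <chi,eta> is the trace of r_chi on
   f R(H).  Finally chi^n is a character of degree chi(1)^n, and characters of
   degree N are bounded by a constant times N, so r_chi / chi(1) is power bounded: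
   its eigenvalues have modulus at most 1 and those of modulus 1 are semisimple. *)
Require Import Defs.
From HB Require Import structures.
From mathcomp Require Import all_boot all_order all_algebra.
From mathcomp Require Import complex Rstruct mxtens zify ring.
From Stdlib Require Rdefinitions Classical_Prop.
Import Order.TTheory GRing.Theory Num.Theory.
Local Open Scope ring_scope.

Set Implicit Arguments.
Unset Strict Implicit.
Unset Printing Implicit Defensive.

(** * Traces and powers of matrices *)

(** No Wedderburn theory of H or of R(H) is set up. Two tools replace it. The first is a Fitting
    dichotomy: an element of a possibly non-unital algebra is nilpotent or has a multiple that is a
    nonzero idempotent. The second is that in characteristic 0 a trace vanishes on nilpotents but
    not on nonzero idempotents. Applied in the centre of H, they make the form p -> <p, Lambda>
    nondegenerate on R(H); applied in f R(H) f, they leave only scalars there. What makes this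
    available is S^2 = 1: it turns lambda and Lambda into symmetric forms and identifies lambda with
    the regular character of H. Every trace function on H is then x -> Tr(z x) on the regular
    representation with z central, which is how R(H) is seen to contain all of them. *)

Lemma mxtrace_idem (F : fieldType) n (A : 'M[F]_n) :
  A *m A = A -> \tr A = (\rank A)%:R.
Proof.
move=> AA.
(* In the rank factorization A = C R, idempotence reads C (R C) R = C R; cancelling the full-rank
   factors leaves R C = 1, of size rank A. *)
have E : col_base A *m (row_base A *m col_base A) *m row_base A
         = col_base A *m 1%:M *m row_base A.
  by rewrite mulmx1 (mulmxA (col_base A) (row_base A)) mulmx_base -(mulmxA A) mulmx_base.
have h := row_full_inj (col_base_full A) (row_free_inj (row_base_free A) E).
by rewrite -{1}(mulmx_base A) mxtrace_mulC h mxtrace1.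
Qed.

Lemma mxtrace_eigen (C : closedFieldType) n (A : 'M[C]_n) :
  exists r : 'I_n -> C, \tr A = \sum_i r i /\
    char_poly A = \prod_i ('X - (r i)%:P).
Proof.
case: n A => [|n] A.
  exists (fun=> 0); rewrite /mxtrace !big_ord0; split=> //.
  by rewrite /char_poly det_mx00.
have [s Ds] := closed_field_poly_normal (char_poly A).
have /monicP lc := char_poly_monic A; rewrite lc scale1r in Ds.
have sz : size s = n.+1.
  by apply/eqP; rewrite -eqSS -(size_char_poly A) Ds size_prod_XsubC.
have Dp : char_poly A = \prod_(i < n.+1) ('X - (s`_i)%:P).
  by rewrite Ds (big_nth 0) sz big_mkord.
exists (fun i => s`_i); split=> //.
apply: oppr_inj; rewrite -char_poly_trace // Ds -sz coefPn_prod_XsubC ?sz //.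
by rewrite (big_nth 0) sz big_mkord.
Qed.

Lemma char_poly_root_eigen (C : closedFieldType) n (A : 'M[C]_n) r :
  char_poly A = \prod_(i < n) ('X - (r i)%:P) -> forall i, exists2 v : 'rV_n, v *m A = r i *: v & v != 0.
Proof.
move=> Dp i; apply/eigenvalueP; rewrite eigenvalue_root_char Dp.
by apply/rootP; rewrite horner_prod (bigD1 i) //= !hornerE subrr mul0r.
Qed.

Lemma mxtrace_nilp (C : closedFieldType) n (A : 'M[C]_n) k : A ^+ k = 0 -> \tr A = 0.
Proof.
move=> Ak; have [r [-> Dp]] := mxtrace_eigen A.
apply: big1 => i _; have [v vA nzv] := char_poly_root_eigen Dp i.
have vAk l : v *m A ^+ l = r i ^+ l *: v.
  elim: l => [|l IH]; first by rewrite !expr0 mulmx1 scale1r.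
  by rewrite exprSr mulmxA IH -scalemxAl vA scalerA -exprSr.
have /eqP := vAk k; rewrite Ak mulmx0 eq_sym scaler_eq0 (negbTE nzv) orbF.
by rewrite expf_eq0 => /andP[_ /eqP].
Qed.

(** An abstract numeric field may contain infinitesimals, so the Archimedean property is carried as
    a hypothesis until the field is [CC]. *)
Lemma bounded_multiples (C : numFieldType) (a b : C) :
  (forall x : C, exists n : nat, `|x| < n%:R) -> 0 <= a ->
  (forall n, n%:R * a <= b) -> a = 0.
Proof.
move=> arch a0 h; apply/eqP; case: eqVneq => // nza; exfalso.
have ap : 0 < a by rewrite lt0r nza.
have [n] := arch (b / a).
have b0 : 0 <= b by have := h 0; rewrite mul0r.
rewrite ger0_norm ?divr_ge0 // ltr_pdivrMr // => /lt_le_trans/(_ (h n)).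
by rewrite ltxx.
Qed.

Lemma bernoulli_ge (C : numFieldType) (h : C) n : 0 <= h -> 1 + n%:R * h <= (1 + h) ^+ n.
Proof.
move=> h0; elim: n => [|n IH]; first by rewrite mul0r addr0.
rewrite exprS; have : (1 + h) * (1 + n%:R * h) <= (1 + h) * (1 + h) ^+ n.
  by rewrite ler_wpM2l // addr_ge0.
apply: le_trans; rewrite -subr_ge0.
rewrite (_ : _ - _ = n%:R * (h * h)); first by rewrite mulr_ge0 // mulr_ge0.
by rewrite -natr1; ring.
Qed.

(** If x = c (1 + h) with h > 0, Bernoulli's inequality puts every multiple n h below [K]. *)
Lemma bounded_powers (C : numFieldType) (x c K : C) :
  (forall x : C, exists n : nat, `|x| < n%:R) -> 0 <= x -> 0 < c ->
  (forall n, x ^+ n <= K * c ^+ n) -> x <= c.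
Proof.
move=> arch x0 c0 h; have xr : x \is Num.real by exact: ger0_real.
have cr : c \is Num.real by exact: gtr0_real.
case: (real_leP xr cr) => // cx.
have: x / c - 1 = 0; last first.
  move/eqP; rewrite subr_eq0 => /eqP e; have := cx.
  by rewrite -[x](divfK (lt0r_neq0 c0)) e mul1r ltxx.
have hh : 0 <= x / c - 1 by rewrite subr_ge0 ler_pdivlMr // mul1r ltW.
apply: (bounded_multiples (b := K)) => // n.
apply: le_trans (_ : (1 + (x / c - 1)) ^+ n <= _); last first.
  by rewrite addrC subrK expr_div_n ler_pdivrMr ?exprn_gt0.
by apply: le_trans (bernoulli_ge n hh); rewrite lerDr.
Qed.

Lemma power_bounded_row (C : numClosedFieldType) (m : nat) (A : 'M[C]_m) (K c : C)
    (v : 'rV[C]_m) :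
  (forall k i j, `|(A ^+ k) i j| <= K * c ^+ k) ->
  exists2 L, 0 <= L & forall k j, `|(v *m A ^+ k) 0 j| <= L * c ^+ k.
Proof.
move=> bA; have K0 : 'I_m -> 0 <= K.
  by move=> i; have := bA 0 i i; rewrite !expr0 mulr1; apply: le_trans.
case: (posnP m) => [m0|m0].
  by exists 0 => // k j; move: (ltn_ord j); rewrite {2}m0.
exists (\sum_i `|v 0 i| * K) => [|k j].
  by apply: sumr_ge0 => i _; rewrite mulr_ge0 // K0.
rewrite mxE (le_trans (ler_norm_sum _ _ _)) // mulr_suml; apply: ler_sum => i _.
by rewrite normrM -mulrA ler_wpM2l.
Qed.

Section PowerBounded.
Variables (C : numClosedFieldType) (m : nat) (A : 'M[C]_m) (K c : C).
Hypothesis arch : forall x : C, exists n : nat, `|x| < n%:R.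
Hypothesis c_gt0 : 0 < c.
Hypothesis bA : forall k i j, `|(A ^+ k) i j| <= K * c ^+ k.

(* In the equality case the eigenvalues coincide, and a nontrivial Jordan block of
   modulus c would make A ^+ k / c ^+ k grow linearly. *)
Lemma power_bounded_trace : `|\tr A| <= m%:R * c /\
  (`|\tr A| = m%:R * c -> exists2 a, `|a| = c & A = a%:M).
Proof.
have [r [Dt Dp]] := mxtrace_eigen A.
have rc i : `|r i| <= c.
  have [v vA nzv] := char_poly_root_eigen Dp i.
  have vAk l : v *m A ^+ l = r i ^+ l *: v.
    elim: l => [|l IH]; first by rewrite !expr0 mulmx1 scale1r.
    by rewrite exprSr mulmxA IH -scalemxAl vA scalerA -exprSr.
  have [j nzj] : exists j, v 0 j != 0 by case/rV0Pn: nzv => j; exists j.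
  have [L L0 bL] := power_bounded_row v bA.
  apply: (bounded_powers (K := L / `|v 0 j|)) => // k.
  have := bL k j; rewrite vAk mxE normrM normrX.
  by rewrite mulrAC ler_pdivlMr // normr_gt0.
have le1 : \sum_(i < m) `|r i| <= m%:R * c.
  rewrite mulr_natl -[X in _ <= _ *+ X](card_ord m) -sumr_const.
  by apply: ler_sum => i _.
have le2 : `|\tr A| <= \sum_(i < m) `|r i| by rewrite Dt ler_norm_sum.
split; first exact: le_trans le1.
move=> eqA.
have e1 : \sum_(i < m) `|r i| = m%:R * c by apply/le_anti; rewrite le1 -eqA le2.
(* Terms of modulus at most c whose moduli sum to m c all have modulus c; equality in the triangle
   inequality then gives them a common direction [t]. *)
have ri i : `|r i| = c.
  apply: (normC_sum_upper (P := xpredT) (F := fun i => `|r i|) (G := fun=> c)) => //.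
    by move=> j _; rewrite normr_id.
  by rewrite e1 sumr_const card_ord mulr_natl.
have [t /eqP t1 rt] := normC_sum_eq (etrans (esym (congr1 Num.norm Dt)) (etrans eqA (esym e1))).
have {}rt i : r i = c * t by rewrite rt // ri.
set a := c * t in rt.
have na : `|a| = c by rewrite normrM t1 mulr1 gtr0_norm.
exists a => //.
clear - bA arch c_gt0 Dp rt na; case: m A bA r Dp rt => [|n] A' bA' r Dp rt.
  by apply/matrixP => -[].
pose N := A' - a%:M.
have Nn : N ^+ n.+1 = 0.
  have := Cayley_Hamilton A'; rewrite Dp (eq_bigr (fun=> 'X - a%:P)) => [|i _]; last by rewrite rt.
  by rewrite prodr_const card_ord rmorphXn /= rmorphB /= horner_mx_X horner_mx_C.
suff : N = 0 by move/eqP; rewrite subr_eq0 => /eqP.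
apply/eqP; case: eqVneq => // nzN; exfalso.
have exk : exists k, N ^+ k.+1 == 0 by exists n; rewrite Nn.
case: (ex_minnP exk) => -[|k]; first by rewrite expr1 (negbTE nzN).
move=> Nk mink; have nzNk : N ^+ k.+1 != 0.
  by apply/negP => /mink; rewrite ltnn.
have [i [j nzij]] : exists i j, (N ^+ k.+1) i j != 0.
  by move/matrix0Pn: nzNk.
(* [v], [w] is a Jordan chain of length two: [w] is nonzero at [j], and minimality of the exponent
   gives w N = 0. The term (l+1) a^l w of v A^(l+1) is the linear growth that contradicts the
   bound. *)
pose v := row i (N ^+ k); pose w := v *m N.
have wE : w = row i (N ^+ k.+1) by rewrite /w /v exprSr row_mul.
have wN : w *m N = 0 by rewrite wE -row_mul -[_ *m _]exprSr (eqP Nk) row0.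
have AE : A' = a%:M + N by rewrite addrC subrK.
have vA l : v *m A' ^+ l.+1 = a ^+ l.+1 *: v + (l.+1%:R * a ^+ l) *: w.
  have wA : w *m A' = a *: w by rewrite AE mulmxDr wN addr0 mul_mx_scalar.
  have vA1 : v *m A' = a *: v + w by rewrite AE mulmxDr mul_mx_scalar.
  elim: l => [|l IH]; first by rewrite !expr1 expr0 mulr1 scale1r.
  rewrite exprSr mulmxA IH mulmxDl -!scalemxAl vA1 wA scalerDr !scalerA -exprSr -addrA -scalerDl.
  by congr (_ + _ *: _); rewrite -natr1 [in RHS]exprSr -natr1 !exprSr; ring.
have [L L0 bL] := power_bounded_row v bA'.
have : `|w 0 j| = 0; last by move/normr0P; rewrite wE mxE (negbTE nzij).
apply: (bounded_multiples (b := (L + `|v 0 j|) * c)) => // -[|l].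
  by rewrite mul0r mulr_ge0 ?addr_ge0 // ltW.
rewrite -(ler_pM2l (exprn_gt0 l c_gt0)).
have -> : c ^+ l * (l.+1%:R * `|w 0 j|) = `|(v *m A' ^+ l.+1) 0 j - a ^+ l.+1 * v 0 j|.
  rewrite vA [X in X - _]mxE [(a ^+ _ *: v) _ _]mxE addrAC subrr add0r.
  by rewrite [X in _ = `|X|]mxE !normrM normrX na normr_nat; ring.
apply: (le_trans (ler_normB _ _)).
have -> : c ^+ l * ((L + `|v 0 j|) * c) = L * c ^+ l.+1 + c ^+ l.+1 * `|v 0 j|.
  by rewrite exprS; ring.
by rewrite lerD // normrM normrX na.
Qed.
End PowerBounded.

(** * Sweedler calculus and duality *)

Section Sweedler.
Variables (C : numClosedFieldType) (d : nat).
Implicit Types (H : hopf_data C d) (x y h p q : 'rV[C]_d).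

(* Passing to dualH H makes convH H the product and exchanges the two kinds of
   integrals, so identities proved for H transfer to H^*. *)
Definition dualH H : hopf_data C d :=
  HopfData (fun a b c => hcomul H c a b) (epsH H) (fun c a b => hmul H a b c)
    (fun k => hunit H 0 k) (hanti H)^T.

(** Row vectors are acted on from the right, so [lmx] reverses products; see [lmxM]. *)
Definition lmx H x : 'M[C]_d := \matrix_(b, c) \sum_a x 0 a * hmul H a b c.
Definition rmx H y : 'M[C]_d := \matrix_(a, c) \sum_b y 0 b * hmul H a b c.

Lemma mulH_rmx H x y : mulH H x y = x *m rmx H y.
Proof.
apply/rowP => c; rewrite !mxE; apply: eq_bigr => a _; rewrite mxE mulr_sumr.
by apply: eq_bigr => b _; rewrite mulrA.
Qed.

Lemma mulH_lmx H x y : mulH H x y = y *m lmx H x.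
Proof.
apply/rowP => c; rewrite !mxE exchange_big; apply: eq_bigr => b _ /=; rewrite mxE mulr_sumr.
by apply: eq_bigr => a _; rewrite mulrCA mulrA.
Qed.

Lemma mulHPl H a x y z : mulH H (a *: x + y) z = a *: mulH H x z + mulH H y z.
Proof. by rewrite !mulH_rmx mulmxDl scalemxAl. Qed.
Lemma mulHPr H a x y z : mulH H z (a *: x + y) = a *: mulH H z x + mulH H z y.
Proof. by rewrite !mulH_lmx mulmxDl scalemxAl. Qed.

Lemma pairH_mx p x : pairH p x = (p *m x^T) 0 0.
Proof. by rewrite mxE; apply: eq_bigr => k _; rewrite mxE. Qed.
Lemma pairHC p x : pairH p x = pairH x p.
Proof. by apply: eq_bigr => k _; rewrite mulrC. Qed.
Lemma pairHPl a p q x : pairH (a *: p + q) x = a * pairH p x + pairH q x.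
Proof. by rewrite !pairH_mx mulmxDl -scalemxAl !mxE. Qed.
Lemma pairHPr a p x y : pairH p (a *: x + y) = a * pairH p x + pairH p y.
Proof. by rewrite ![pairH p _]pairHC pairHPl. Qed.
Lemma antiHP H a x y : antiH H (a *: x + y) = a *: antiH H x + antiH H y.
Proof. by rewrite /antiH mulmxDl scalemxAl. Qed.

Lemma pairH_ebas p k : pairH p (ebas C k) = p 0 k.
Proof.
rewrite /pairH (bigD1 k) //= big1 => [|i ik]; first by rewrite mxE !eqxx mulr1 addr0.
by rewrite mxE (negbTE ik) andbF mulr0.
Qed.

Lemma pairH_inj p q : (forall h, pairH p h = pairH q h) -> p = q.
Proof. by move=> e; apply/rowP => k; rewrite -!pairH_ebas. Qed.
Lemma pairH_injr x y : (forall p, pairH p x = pairH p y) -> x = y.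
Proof. by move=> e; apply: pairH_inj => h; rewrite ![pairH _ h]pairHC. Qed.

(** A predicate on bare functions, since the integrands of Sweedler sums are lambda terms built on
    the fly. *)
Definition lin (g : 'rV[C]_d -> C) := forall a x y, g (a *: x + y) = a * g x + g y.

Lemma linE g x : lin g -> g x = \sum_k x 0 k * g (ebas C k).
Proof.
move=> lg; have g0 : g 0 = 0.
  by have := lg (-1) 0 0; rewrite scaler0 addr0 mulN1r addNr.
rewrite {1}(row_sum_delta x).
apply: (big_ind2 (fun u v => g u = v)) => // [u _ v _ <- <-|k _].
  by rewrite -[u]scale1r lg mul1r scale1r.
by rewrite -[_ *: _]addr0 lg g0 addr0.
Qed.

(* Sweedler notation: sw H G h stands for sum G(h_1, h_2), G bilinear. *)
Definition sw H (G : 'rV[C]_d -> 'rV[C]_d -> C) h : C :=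
  \sum_c \sum_a \sum_b h 0 c * hcomul H c a b * G (ebas C a) (ebas C b).

Lemma sw_ebas H G c : sw H G (ebas C c) =
  \sum_a \sum_b hcomul H c a b * G (ebas C a) (ebas C b).
Proof.
rewrite /sw (bigD1 c) //= [X in _ + X]big1 ?addr0 => [|i ic].
  by apply: eq_bigr => a _; apply: eq_bigr => b _; rewrite mxE !eqxx mul1r.
apply: big1 => a _; apply: big1 => b _.
by rewrite mxE (negbTE ic) andbF !mul0r.
Qed.

Lemma swP H G : lin (sw H G).
Proof.
move=> a x y; rewrite /sw mulr_sumr -big_split; apply: eq_bigr => c _ /=.
rewrite mulr_sumr -big_split; apply: eq_bigr => i _ /=.
rewrite mulr_sumr -big_split; apply: eq_bigr => j _ /=.
by rewrite !mxE; ring.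
Qed.

Lemma swE H G h : sw H G h = \sum_c h 0 c * sw H G (ebas C c).
Proof. exact: linE (swP H G). Qed.

Lemma eq_sw H G G' h : (forall x y, G x y = G' x y) -> sw H G h = sw H G' h.
Proof.
by move=> e; do 3 (apply: eq_bigr => ? _); rewrite e.
Qed.

Lemma swZ H G a h : sw H (fun x y => a * G x y) h = a * sw H G h.
Proof.
rewrite /sw mulr_sumr; apply: eq_bigr => c _; rewrite mulr_sumr; apply: eq_bigr => i _.
by rewrite mulr_sumr; apply: eq_bigr => j _; rewrite mulrCA.
Qed.

Lemma swZr H G a h : sw H (fun x y => G x y * a) h = sw H G h * a.
Proof. by rewrite mulrC -swZ; apply: eq_sw => x y; rewrite mulrC. Qed.

Lemma swD H G G' h : sw H (fun x y => G x y + G' x y) h = sw H G h + sw H G' h.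
Proof.
rewrite /sw -big_split; apply: eq_bigr => c _ /=; rewrite -big_split; apply: eq_bigr => i _ /=.
by rewrite -big_split; apply: eq_bigr => j _ /=; rewrite mulrDr.
Qed.

Lemma sw_sum H (I : finType) (G : I -> _) h :
  sw H (fun x y => \sum_i G i x y) h = \sum_i sw H (G i) h.
Proof.
rewrite /sw [RHS]exchange_big; apply: eq_bigr => c _ /=.
rewrite [RHS]exchange_big; apply: eq_bigr => i _ /=.
by rewrite [RHS]exchange_big; apply: eq_bigr => j _ /=; rewrite mulr_sumr.
Qed.

Lemma sw_exchange H H' G h k :
  sw H (fun x y => sw H' (fun u v => G x y u v) k) h =
  sw H' (fun u v => sw H (fun x y => G x y u v) h) k.
Proof.
rewrite [RHS]/(sw H' (fun u v => \sum_c \sum_a \sum_b _) k) sw_sum; apply: eq_bigr => c _.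
by rewrite sw_sum; apply: eq_bigr => a _; rewrite sw_sum; apply: eq_bigr => b _; rewrite swZ.
Qed.

Lemma pairH_conv H p q h : pairH (convH H p q) h = sw H (fun x y => pairH p x * pairH q y) h.
Proof.
rewrite /pairH; apply: eq_bigr => c _; rewrite mxE mulr_suml; apply: eq_bigr => a _.
rewrite mulr_suml; apply: eq_bigr => b _; rewrite -!/(pairH _ _) !pairH_ebas; ring.
Qed.

Lemma pairH_harp H p q h : pairH q (harp H h p) = pairH (convH H p q) h.
Proof.
rewrite pairH_conv /sw /pairH.
under eq_bigr do rewrite mxE mulr_sumr.
rewrite exchange_big; apply: eq_bigr => c _ /=.
under eq_bigr do rewrite mulr_sumr.
rewrite exchange_big; apply: eq_bigr => a _ /=; apply: eq_bigr => b _.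
by rewrite -!/(pairH _ _) !pairH_ebas; ring.
Qed.

Lemma convHE H p q : convH H p q = mulH (dualH H) p q.
Proof.
apply/rowP => c; rewrite !mxE; apply: eq_bigr => a _; apply: eq_bigr => b _ /=.
by rewrite -mulrA mulrC.
Qed.

Lemma mulH_dual H x y : convH (dualH H) x y = mulH H x y.
Proof.
apply/rowP => c; rewrite !mxE; apply: eq_bigr => a _; apply: eq_bigr => b _ /=.
by rewrite -mulrA mulrC.
Qed.

Lemma epsH_dual H : epsH (dualH H) = hunit H.
Proof. by apply/rowP => k; rewrite mxE. Qed.

Lemma mulH_ebas H a b c : mulH H (ebas C a) (ebas C b) 0 c = hmul H a b c.
Proof.
rewrite mulH_rmx /ebas -rowE !mxE (bigD1 b) //= big1 ?addr0.
  by rewrite mxE !eqxx mul1r.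
by move=> i ib; rewrite mxE (negbTE ib) andbF mul0r.
Qed.

Lemma mulH_ebasr H x b c : mulH H x (ebas C b) 0 c = \sum_a x 0 a * hmul H a b c.
Proof.
rewrite mxE; apply: eq_bigr => a _; rewrite (bigD1 b) //= big1 => [|i ib].
  by rewrite mxE !eqxx mulr1 addr0.
by rewrite mxE (negbTE ib) andbF mulr0 mul0r.
Qed.

Lemma mulH_ebasl H y a c : mulH H (ebas C a) y 0 c = \sum_b y 0 b * hmul H a b c.
Proof.
rewrite mulH_rmx /ebas -rowE !mxE; by apply: eq_bigr => b _.
Qed.

End Sweedler.

(** * The Hopf algebra axioms in Sweedler form *)

Section HopfRules.
Variables (C : numClosedFieldType) (d : nat) (H : hopf_data C d).
Hypothesis hH : is_hopf H.
Implicit Types (x y h p q : 'rV[C]_d).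
Local Notation "x ** y" := (mulH H x y) (at level 40, left associativity).
Local Notation e_ := (ebas C).

Lemma mulHA x y z : x ** y ** z = x ** (y ** z).
Proof. by case: hH => [[]]. Qed.
Lemma mul1H x : hunit H ** x = x.
Proof. by case: hH => [[_ /(_ x)[]]]. Qed.
Lemma mulH1 x : x ** hunit H = x.
Proof. by case: hH => [[_ /(_ x)[]]]. Qed.

Lemma sw_coassoc (G : 'rV[C]_d -> 'rV[C]_d -> 'rV[C]_d -> C) h :
  sw H (fun x y => sw H (fun x1 x2 => G x1 x2 y) x) h =
  sw H (fun x y => sw H (fun y1 y2 => G x y1 y2) y) h.
Proof.
have [_ coass _ _ _] := hH.
rewrite swE [RHS]swE; apply: eq_bigr => c _; congr (_ * _); rewrite !sw_ebas.
transitivity (\sum_b \sum_a \sum_e (\sum_k hcomul H c k e * hcomul H k a b) * G (e_ a) (e_ b) (e_ e)).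
  rewrite exchange_big; transitivity (\sum_e \sum_k \sum_b \sum_a hcomul H c k e * hcomul H k a b * G (e_ a) (e_ b) (e_ e)).
    apply: eq_bigr => e _; apply: eq_bigr => k _; rewrite sw_ebas mulr_sumr exchange_big.
    by apply: eq_bigr => b _; rewrite mulr_sumr; apply: eq_bigr => a _; rewrite mulrA.
  under [RHS]eq_bigr => b _ do rewrite exchange_big.
  rewrite [RHS]exchange_big; apply: eq_bigr => e _ /=; rewrite exchange_big; apply: eq_bigr => b _ /=.
  by rewrite exchange_big; apply: eq_bigr => a _ /=; rewrite mulr_suml.
rewrite exchange_big; apply: eq_bigr => a _ /=.
transitivity (\sum_b \sum_e \sum_k hcomul H c a k * hcomul H k b e * G (e_ a) (e_ b) (e_ e)).
  by apply: eq_bigr => b _; apply: eq_bigr => e _; rewrite coass mulr_suml.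
rewrite exchange_big; under eq_bigr => e _ do rewrite exchange_big.
rewrite exchange_big; apply: eq_bigr => k _ /=; rewrite sw_ebas mulr_sumr exchange_big.
by apply: eq_bigr => b _; rewrite mulr_sumr; apply: eq_bigr => e _; rewrite mulrA.
Qed.

Lemma pairH_eps k : pairH (epsH H) (e_ k) = hcounit H k.
Proof. by rewrite pairH_ebas mxE. Qed.

Lemma sw_counitl g h : lin g -> sw H (fun x y => pairH (epsH H) x * g y) h = g h.
Proof.
move=> lg; have [_ _ [cu _] _ _] := hH.
rewrite swE [RHS]linE //; apply: eq_bigr => c _; congr (_ * _); rewrite sw_ebas exchange_big.
rewrite (bigD1 c) //= [X in _ + X]big1 => [|b bc].
  have := cu c c; rewrite eqxx => /esym e; rewrite addr0 -[RHS]mul1r [X in _ = X * _]e mulr_suml.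
  by apply: eq_bigr => a _; rewrite pairH_eps; ring.
transitivity ((\sum_a hcounit H a * hcomul H c a b) * g (e_ b)).
  by rewrite mulr_suml; apply: eq_bigr => a _; rewrite pairH_eps; ring.
by rewrite cu eq_sym (negbTE bc) mul0r.
Qed.

Lemma sw_counitr g h : lin g -> sw H (fun x y => g x * pairH (epsH H) y) h = g h.
Proof.
move=> lg; have [_ _ [_ cu] _ _] := hH.
rewrite swE [RHS]linE //; apply: eq_bigr => c _; congr (_ * _); rewrite sw_ebas.
rewrite (bigD1 c) //= [X in _ + X]big1 => [|b bc].
  have := cu c c; rewrite eqxx => /esym e; rewrite addr0 -[RHS]mul1r [X in _ = X * _]e mulr_suml.
  by apply: eq_bigr => a _; rewrite pairH_eps; ring.
transitivity ((\sum_a hcounit H a * hcomul H c b a) * g (e_ b)).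
  by rewrite mulr_suml; apply: eq_bigr => a _; rewrite pairH_eps; ring.
by rewrite cu eq_sym (negbTE bc) mul0r.
Qed.

Lemma lin_sum g (I : finType) (f : I -> 'rV[C]_d) : lin g -> g (\sum_i f i) = \sum_i g (f i).
Proof.
move=> lg; have g0 : g 0 = 0.
  by have := lg (-1) 0 0; rewrite scaler0 addr0 mulN1r addNr.
by elim/big_rec2: _ => // i u v _ <-; rewrite -[f i]scale1r lg mul1r scale1r.
Qed.

Lemma linZ g a x : lin g -> g (a *: x) = a * g x.
Proof.
move=> lg; have g0 : g 0 = 0.
  by have := lg (-1) 0 0; rewrite scaler0 addr0 mulN1r addNr.
by rewrite -[_ *: _]addr0 lg g0 addr0.
Qed.

Lemma sw_antil g h : lin g -> sw H (fun x y => g (antiH H x ** y)) h = pairH (epsH H) h * g (hunit H).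
Proof.
move=> lg; have [_ _ _ _ [an _]] := hH.
rewrite swE {1}/pairH mulr_suml; apply: eq_bigr => c _; rewrite mxE sw_ebas mulrAC [_ * h 0 c]mulrC.
congr (_ * _); rewrite -linZ // -an lin_sum //; apply: eq_bigr => a _.
by rewrite lin_sum //; apply: eq_bigr => b _; rewrite linZ.
Qed.

Lemma sw_antir g h : lin g -> sw H (fun x y => g (x ** antiH H y)) h = pairH (epsH H) h * g (hunit H).
Proof.
move=> lg; have [_ _ _ _ [_ an]] := hH.
rewrite swE {1}/pairH mulr_suml; apply: eq_bigr => c _; rewrite mxE sw_ebas mulrAC [_ * h 0 c]mulrC.
congr (_ * _); rewrite -linZ // -an lin_sum //; apply: eq_bigr => a _.
by rewrite lin_sum //; apply: eq_bigr => b _; rewrite linZ.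
Qed.

Lemma sw_unit G : (forall y, lin (G^~ y)) -> (forall x, lin (G x)) ->
  sw H G (hunit H) = G (hunit H) (hunit H).
Proof.
move=> lG1 lG2; have [_ _ _ [_ un _ _] _] := hH.
rewrite /sw exchange_big [RHS](linE _ (lG1 _)); apply: eq_bigr => a _ /=.
rewrite exchange_big (linE _ (lG2 _)) mulr_sumr; apply: eq_bigr => b _ /=.
by rewrite -mulr_suml un mulrA.
Qed.

Lemma sw_mul G x y : (forall y, lin (G^~ y)) -> (forall x, lin (G x)) ->
  sw H G (x ** y) = sw H (fun x1 x2 => sw H (fun y1 y2 => G (x1 ** y1) (x2 ** y2)) y) x.
Proof.
move=> lG1 lG2; have [_ _ _ [mc _ _ _] _] := hH.
have l1 z : lin (fun x => sw H G (x ** z)) by move=> a u v; rewrite mulHPl swP.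
have l2 z : lin (fun y => sw H G (z ** y)) by move=> a u v; rewrite mulHPr swP.
rewrite (linE x (l1 y)) [RHS]swE; apply: eq_bigr => a _; congr (_ * _).
rewrite (linE y (l2 _)) sw_exchange [RHS]swE; apply: eq_bigr => b _; congr (_ * _).
rewrite sw_ebas [LHS]/sw.
transitivity (\sum_x1 \sum_y1 \sum_x2 \sum_y2 hcomul H a x1 y1 * hcomul H b x2 y2 *
   G (e_ x1 ** e_ x2) (e_ y1 ** e_ y2)); last first.
  under eq_bigr => x1 _ do rewrite exchange_big.
  rewrite exchange_big; apply: eq_bigr => x2 _ /=.
  under eq_bigr => x1 _ do rewrite exchange_big.
  rewrite exchange_big; apply: eq_bigr => y2 _ /=; rewrite sw_ebas mulr_sumr.
  apply: eq_bigr => x1 _; rewrite mulr_sumr; apply: eq_bigr => y1 _; ring.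
transitivity (\sum_u \sum_v (\sum_x1 \sum_y1 \sum_x2 \sum_y2
   hcomul H a x1 y1 * hcomul H b x2 y2 * hmul H x1 x2 u * hmul H y1 y2 v) * G (e_ u) (e_ v)).
  rewrite exchange_big; apply: eq_bigr => u _ /=; rewrite exchange_big; apply: eq_bigr => v _ /=.
  by rewrite -mc mulr_suml; apply: eq_bigr => c _; rewrite mulH_ebas.
transitivity (\sum_u \sum_v (\sum_x1 \sum_y1 \sum_x2 \sum_y2
   hcomul H a x1 y1 * hcomul H b x2 y2 * hmul H x1 x2 u * hmul H y1 y2 v * G (e_ u) (e_ v))).
  apply: eq_bigr => u _; apply: eq_bigr => v _; do 4 (rewrite mulr_suml; apply: eq_bigr => ? _).
  by [].
under eq_bigr => u _. rewrite exchange_big /=. over.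
rewrite exchange_big; apply: eq_bigr => x1 _ /=.
under eq_bigr => u _. under eq_bigr => v _. over. rewrite exchange_big /=. over.
rewrite exchange_big; apply: eq_bigr => y1 _ /=.
under eq_bigr => u _. rewrite exchange_big /=. over.
rewrite exchange_big; apply: eq_bigr => x2 _ /=.
under eq_bigr => u _. rewrite exchange_big /=. over.
rewrite exchange_big; apply: eq_bigr => y2 _ /=.
rewrite (linE _ (lG1 _)) mulr_sumr; apply: eq_bigr => u _.
rewrite (linE _ (lG2 _)) !mulr_sumr; apply: eq_bigr => v _; rewrite !mulH_ebas; ring.
Qed.

Lemma eps_mul x y : pairH (epsH H) (x ** y) = pairH (epsH H) x * pairH (epsH H) y.
Proof.
have [_ _ _ [_ _ em _] _] := hH.
have l1 z : lin (fun x => pairH (epsH H) (x ** z)) by move=> a u v; rewrite mulHPl pairHPr.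
have l2 z : lin (fun y => pairH (epsH H) (z ** y)) by move=> a u v; rewrite mulHPr pairHPr.
rewrite (linE x (l1 y)) {2 3}/pairH mulr_suml; apply: eq_bigr => a _.
rewrite (linE y (l2 _)) !mulr_sumr; apply: eq_bigr => b _.
rewrite !mxE.
transitivity (x 0 a * (y 0 b * (hcounit H a * hcounit H b))); last by ring.
rewrite -em; congr (_ * (_ * _)); rewrite /pairH; apply: eq_bigr => c _.
by rewrite mulH_ebas mxE mulrC.
Qed.

Lemma eps_unit : pairH (epsH H) (hunit H) = 1.
Proof.
have [_ _ _ [_ _ _ <-] _] := hH; apply: eq_bigr => c _; by rewrite mxE mulrC.
Qed.

End HopfRules.

(** * The dual Hopf algebra *)

Section Duality.
Variables (C : numClosedFieldType) (d : nat) (H : hopf_data C d).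
Implicit Types (x y h p q L l : 'rV[C]_d).
Local Notation e_ := (ebas C).

Lemma integral_dual L : integralH H L -> integralHdual (dualH H) L.
Proof.
by move=> iL p; rewrite !mulH_dual pairHC; apply: iL.
Qed.

Lemma dual_integral l : integralHdual H l -> integralH (dualH H) l.
Proof.
by move=> il p; rewrite -!convHE epsH_dual pairHC; apply: il.
Qed.

Hypothesis hH : is_hopf H.

Lemma convHA p q r : convH H (convH H p q) r = convH H p (convH H q r).
Proof.
apply: pairH_inj => h; rewrite !pairH_conv.
transitivity (sw H (fun x y => sw H (fun x1 x2 => pairH p x1 * pairH q x2 * pairH r y) x) h).
  by apply: eq_sw => x y; rewrite pairH_conv swZr.
rewrite (sw_coassoc hH (fun x1 x2 y => pairH p x1 * pairH q x2 * pairH r y)).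
by apply: eq_sw => x y; rewrite pairH_conv -swZ; apply: eq_sw => u v; rewrite mulrA.
Qed.

Lemma conv1H p : convH H (epsH H) p = p.
Proof.
apply: pairH_inj => h; rewrite pairH_conv; apply: (sw_counitl hH) => a x y; exact: pairHPr.
Qed.

Lemma convH1 p : convH H p (epsH H) = p.
Proof.
apply: pairH_inj => h; rewrite pairH_conv; apply: (sw_counitr hH) => a x y; exact: pairHPr.
Qed.

(** Every axiom is the transpose of an axiom of [H]: associativity and coassociativity, unit and
    counit change places, while compatibility of product and coproduct is self-dual up to exchanging
    the two middle summation indices. *)
Lemma is_hopf_dual : is_hopf (dualH H).
Proof.
have hH' := hH; case: hH' => _ coass [cu1 cu2] [mc un em eu] [an1 an2].
split.
- split=> [x y z|x]; first by rewrite -!convHE convHA.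
  by rewrite -!convHE conv1H convH1.
- move=> c a b e /=; have /rowP/(_ c) := mulHA hH (e_ a) (e_ b) (e_ e).
  rewrite mulH_ebasr mulH_ebasl => eq.
  transitivity (\sum_k mulH H (e_ a) (e_ b) 0 k * hmul H k e c).
    by apply: eq_bigr => k _; rewrite mulH_ebas mulrC.
  by rewrite eq; apply: eq_bigr => k _; rewrite mulH_ebas mulrC.
- split=> [c b|c a] /=.
    by rewrite -mulH_ebasr (mul1H hH) mxE eqxx.
  by rewrite -mulH_ebasl (mulH1 hH) mxE eqxx.
- split=> [a b x y|x y|a b|] /=.
  + transitivity (\sum_c hmul H x y c * hcomul H c a b).
      by apply: eq_bigr => c _; rewrite mulrC.
    rewrite mc; apply: eq_bigr => x1 _; rewrite exchange_big; apply: eq_bigr => y1 _ /=.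
    apply: eq_bigr => x2 _; apply: eq_bigr => y2 _; ring.
  + rewrite !mxE -em; apply: eq_bigr => c _; rewrite mxE; ring.
  + rewrite -un; apply: eq_bigr => c _; ring.
  + by rewrite -eu; apply: eq_bigr => c _; rewrite mxE mulrC.
- split=> c /=; apply/rowP => k.
  + have /rowP/(_ c) := an1 k; rewrite !mxE => eq.
    rewrite mulrC -eq {eq}.
    rewrite !summxE; under eq_bigr => a _ do rewrite summxE.
    under [RHS]eq_bigr => a _ do rewrite summxE.
    transitivity (\sum_a \sum_b \sum_i hmul H a b c * (hanti H i a * hcomul H k i b)).
      apply: eq_bigr => a _; apply: eq_bigr => b _.
      rewrite !mxE mulr_sumr; apply: eq_bigr => i _; rewrite (bigD1 b) //= big1 => [|j jb].
        by rewrite /antiH /ebas -rowE !mxE !eqxx mulr1 addr0.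
      by rewrite !mxE (negbTE jb) andbF mulr0 mul0r.
    symmetry; transitivity (\sum_i \sum_b \sum_a hmul H a b c * (hanti H i a * hcomul H k i b)).
      apply: eq_bigr => i _; apply: eq_bigr => b _.
      rewrite !mxE mulr_sumr; apply: eq_bigr => a _; rewrite (bigD1 b) //= big1 => [|j jb].
        rewrite /antiH /ebas -rowE !mxE !eqxx mulr1 addr0; ring.
      by rewrite !mxE (negbTE jb) andbF mulr0 mul0r.
    under eq_bigr => i _ do rewrite exchange_big.
    rewrite exchange_big; apply: eq_bigr => a _ /=; by rewrite exchange_big.
  + have /rowP/(_ c) := an2 k; rewrite !mxE => eq.
    rewrite mulrC -eq {eq}.
    rewrite !summxE; under eq_bigr => a _ do rewrite summxE.
    under [RHS]eq_bigr => a _ do rewrite summxE.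
    transitivity (\sum_a \sum_b \sum_i hmul H a b c * (hanti H i b * hcomul H k a i)).
      apply: eq_bigr => a _; apply: eq_bigr => b _.
      rewrite mxE mulH_ebasl mulr_sumr; apply: eq_bigr => i _.
      by rewrite /antiH /ebas -rowE !mxE.
    symmetry; transitivity (\sum_a \sum_i \sum_b hmul H a b c * (hanti H i b * hcomul H k a i)).
      apply: eq_bigr => a _; apply: eq_bigr => i _.
      rewrite mxE mulH_ebasl mulr_sumr; apply: eq_bigr => b _.
      rewrite /antiH /ebas -rowE !mxE; ring.
    by apply: eq_bigr => a _; rewrite exchange_big.
Qed.

Lemma linpair z : lin (fun x => pairH z x). Proof. by move=> a x y; exact: pairHPr. Qed.

End Duality.

(** * Moving elements across an integral *)

Section Integrals.
Variables (C : numClosedFieldType) (d : nat) (H : hopf_data C d).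
Hypothesis hH : is_hopf H.
Implicit Types (a b x y h p q L l : 'rV[C]_d).
Local Notation e_ := (ebas C).
Local Notation "x ** y" := (mulH H x y) (at level 40, left associativity).
Local Notation pr := (@pairH C d).
Local Notation S := (antiH H).
Local Notation one := (hunit H).
Local Notation eps := (epsH H).

Lemma lin_pairH (g : 'rV[C]_d -> C) x : lin g -> g x = pr (\row_k g (e_ k)) x.
Proof. by move=> lg; rewrite (linE x lg); apply: eq_bigr => k _; rewrite mxE mulrC. Qed.

Lemma sw_integralr l g h : integralHdual H l -> lin g ->
  sw H (fun x y => pr l x * g y) h = pr l h * g one.
Proof.
move=> il lg; rewrite (lin_pairH one lg); set q := \row_k _.
have -> : sw H (fun x y => pr l x * g y) h = sw H (fun x y => pr l x * pr q y) h.
  by apply: eq_sw => x y; rewrite -lin_pairH.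
rewrite -pairH_conv (proj2 (il _)) [LHS]pairHC (linZ _ _ (linpair _)) mulrC.
by rewrite pairHC.
Qed.

Lemma sw_integrall l g h : integralHdual H l -> lin g ->
  sw H (fun x y => g x * pr l y) h = g one * pr l h.
Proof.
move=> il lg; rewrite (lin_pairH one lg); set q := \row_k _.
have -> : sw H (fun x y => g x * pr l y) h = sw H (fun x y => pr q x * pr l y) h.
  by apply: eq_sw => x y; rewrite -lin_pairH.
rewrite -pairH_conv (proj1 (il _)) [LHS]pairHC (linZ _ _ (linpair _)).
by rewrite [pr h l]pairHC.
Qed.

(** Insert b_2 S(b_3), which collapses to the counit: a_1 b (x) a_2 = a_1 b_1 (x) a_2 b_2 S(b_3),
    and the factors before S(b_3) form Delta(a b_1). *)
Lemma sw_mul_antir f g a b : lin f -> lin g ->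
  sw H (fun a1 a2 => f (a1 ** b) * g a2) a =
  sw H (fun b' b3 => sw H (fun x1 x2 => f x1 * g (x2 ** S b3)) (a ** b')) b.
Proof.
move=> lf lg.
transitivity (sw H (fun b1 b' => sw H (fun a1 a2 =>
    sw H (fun b11 b12 => f (a1 ** b11) * g (a2 ** b12 ** S b')) b1) a) b); last first.
  apply: eq_sw => b1 b'; rewrite (sw_mul hH) // => [y c u v|x c u v].
    by rewrite lf; ring.
  by rewrite mulHPl lg; ring.
rewrite [RHS]sw_exchange; apply: eq_sw => a1 a2.
rewrite (sw_coassoc hH (fun b11 b12 b' => f (a1 ** b11) * g (a2 ** b12 ** S b'))).
transitivity (sw H (fun x y => (f (a1 ** x) * g a2) * pr eps y) b).
  rewrite (sw_counitr hH) // => c u v.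
  by rewrite mulHPr lf; ring.
apply: eq_sw => x y; rewrite -mulrA.
transitivity (f (a1 ** x) * sw H (fun y1 y2 => g (a2 ** (y1 ** S y2))) y); last first.
  rewrite -swZ; by apply: eq_sw => u v; rewrite (mulHA hH).
have -> : sw H (fun y1 y2 => g (a2 ** (y1 ** S y2))) y = pr eps y * g a2.
  rewrite (sw_antir hH (g := fun z => g (a2 ** z))) ?(mulH1 hH) //.
  by move=> c u v; rewrite mulHPr lg.
by rewrite [_ * g a2]mulrC.
Qed.

(* sum l(a_1 b) a_2 = sum l(a b_1) S(b_2). *)
Lemma integral_swap_right l g a b : integralHdual H l -> lin g ->
  sw H (fun a1 a2 => pr l (a1 ** b) * g a2) a =
  sw H (fun b1 b2 => pr l (a ** b1) * g (S b2)) b.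
Proof.
move=> il lg; rewrite (sw_mul_antir _ _ (linpair l) lg).
apply: eq_sw => b1 b'; rewrite (sw_integralr _ il) ?(mul1H hH) //.
by move=> c x y; rewrite mulHPl lg.
Qed.

(* sum S(a_1) l(a_2 b) = sum b_1 l(a b_2). *)
Lemma integral_swap_left l g a b : integralHdual H l -> lin g ->
  sw H (fun a1 a2 => g (S a1) * pr l (a2 ** b)) a =
  sw H (fun b1 b2 => g b1 * pr l (a ** b2)) b.
Proof.
move=> il lg.
(* The integral property read backwards: l(a_2 b) 1 becomes (a_2 b)_1 l((a_2 b)_2). After
   coassociativity the factor S(a_1) a_2 collapses to the counit. *)
transitivity (sw H (fun a' a2 => sw H (fun x1 x2 => g (S a' ** x1) * pr l x2) (a2 ** b)) a).
  apply: eq_sw => a' a2; rewrite (sw_integrall _ il).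
    by rewrite (mulH1 hH).
  by move=> c x y; rewrite mulHPr lg.
transitivity (sw H (fun a' a2 => sw H (fun a21 a22 =>
    sw H (fun b1 b2 => g (S a' ** (a21 ** b1)) * pr l (a22 ** b2)) b) a2) a).
  apply: eq_sw => b1 b'; rewrite (sw_mul hH) // => [y c u v|x c u v].
    by rewrite mulHPr lg; ring.
  by rewrite !pairHPr; ring.
rewrite -(sw_coassoc hH (fun a' a21 a22 => sw H (fun b1 b2 => g (S a' ** (a21 ** b1)) * pr l (a22 ** b2)) b)).
transitivity (sw H (fun b1 b2 => sw H (fun x y => sw H (fun x1 x2 => g (S x1 ** (x2 ** b1)) * pr l (y ** b2)) x) a) b).
  by rewrite -sw_exchange; apply: eq_sw => x y; rewrite sw_exchange.
apply: eq_sw => b1 b2.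
transitivity (sw H (fun x y => pr eps x * (g b1 * pr l (y ** b2))) a).
  apply: eq_sw => x y; rewrite swZr mulrA; congr (_ * _).
  transitivity (sw H (fun y1 y2 => g ((S y1 ** y2) ** b1)) x).
    by apply: eq_sw => u v; rewrite (mulHA hH).
  by rewrite (sw_antil hH (g := fun z => g (z ** b1))) ?(mul1H hH) => // c u v; rewrite mulHPl lg.
by rewrite (sw_counitl hH) // => c u v; rewrite mulHPl pairHPr; ring.
Qed.

End Integrals.

(** * Integrals as Frobenius forms *)

Lemma bilin_inj (F : fieldType) m n (A B : 'M[F]_(m, n)) :
  (forall (u : 'rV_m) (v : 'rV_n), (u *m A *m v^T) 0 0 = (u *m B *m v^T) 0 0) -> A = B.
Proof.
move=> e; apply/matrixP => i j; have := e (delta_mx 0 i) (delta_mx 0 j).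
by rewrite -!rowE trmx_delta -!colE !mxE.
Qed.

Lemma mx11_tr (R : Type) (A : 'M[R]_1) : A 0 0 = A^T 0 0.
Proof. by rewrite mxE. Qed.

Section Frobenius.
Variables (C : numClosedFieldType) (d : nat) (H : hopf_data C d).
Implicit Types (a b x y h p q L l : 'rV[C]_d).
Local Notation e_ := (ebas C).
Local Notation "x ** y" := (mulH H x y) (at level 40, left associativity).
Local Notation pr := (@pairH C d).
Local Notation S := (hanti H).
Local Notation one := (hunit H).
Local Notation eps := (epsH H).

(** [gram l] is the matrix of the Frobenius form (x, y) -> l(xy), and [comx h] is the tensor
    Delta(h) written as a matrix. *)
Definition gram l : 'M[C]_d := \matrix_(a, b) pr l (e_ a ** e_ b).
Definition comx h : 'M[C]_d := \matrix_(a, b) \sum_c h 0 c * hcomul H c a b.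

Lemma gramE l x y : pr l (x ** y) = (x *m gram l *m y^T) 0 0.
Proof.
have l1 z : lin (fun x => pr l (x ** z)) by move=> c u v; rewrite mulHPl pairHPr.
have l2 z : lin (fun y => pr l (z ** y)) by move=> c u v; rewrite mulHPr pairHPr.
rewrite (linE y (l2 x)) mxE; apply: eq_bigr => b _.
rewrite (linE x (l1 _)) !mxE mulrC; congr (_ * _); apply: eq_bigr => a _.
by rewrite mxE.
Qed.

Lemma comxE h p q : sw H (fun x y => pr p x * pr q y) h = (p *m comx h *m q^T) 0 0.
Proof.
rewrite /sw exchange_big !mxE.
transitivity (\sum_a \sum_b \sum_c h 0 c * hcomul H c a b * (p 0 a * q 0 b)).
  apply: eq_bigr => a _; rewrite exchange_big; apply: eq_bigr => b _; apply: eq_bigr => c _.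
  by rewrite !pairH_ebas.
rewrite exchange_big; apply: eq_bigr => b _ /=; rewrite !mxE mulr_suml; apply: eq_bigr => a _.
by rewrite mxE mulr_sumr mulr_suml; apply: eq_bigr => c _; ring.
Qed.

Lemma tr_comx (N : 'M[C]_d) h :
  \tr (N *m (comx h)^T) = sw H (fun x y => (x *m N *m y^T) 0 0) h.
Proof.
rewrite /sw exchange_big; apply: eq_bigr => a _; rewrite mxE exchange_big; apply: eq_bigr => b _.
have -> : ((comx h)^T b a) = \sum_c h 0 c * hcomul H c a b by rewrite !mxE.
rewrite mulr_sumr; apply: eq_bigr => c _ /=.
by rewrite trmx_delta -colE -rowE !mxE mulrC.
Qed.

Lemma lin_harp (g : 'rV[C]_d -> C) h p : lin g ->
  g (harp H h p) = sw H (fun x y => pr p x * g y) h.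
Proof.
move=> lg; rewrite (lin_pairH _ lg) pairH_harp pairH_conv.
by apply: eq_sw => x y; rewrite -(lin_pairH _ lg).
Qed.

Lemma harp_mx h p : harp H h p = h *m (lconv H p)^T.
Proof.
apply/rowP => b; rewrite !mxE; apply: eq_bigr => c _.
rewrite !mxE mulr_sumr; apply: eq_bigr => a _; rewrite (bigD1 b) //= big1 ?addr0.
  by rewrite mxE !eqxx mulr1 mulrA.
by move=> i ib; rewrite mxE (negbTE ib) andbF mulr0.
Qed.

Variables (l L : 'rV[C]_d).
Hypotheses (hH : is_hopf H) (il : integralHdual H l) (iL : integralH H L)
  (lL : pr l L = 1).

Local Notation M := (gram l).
Local Notation K := (comx L).

Lemma mulHL a : a ** L = pr eps a *: L. Proof. by case: (iL a). Qed.
Lemma mulLH a : L ** a = pr eps a *: L. Proof. by case: (iL a). Qed.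
Lemma pr_lZL c : pr l (c *: L) = c.
Proof. by rewrite (linZ _ _ (linpair l)) lL mulr1. Qed.

Lemma linantiH g : lin g -> lin (fun z => g (antiH H z)).
Proof. by move=> lg c u v; rewrite antiHP lg. Qed.

(** This and the next three identities are the two swap rules with one argument equal to [L]:
    absorption by [L] collapses one side to a counit. They make Delta(L) the inverse of the form
    l(xy) up to the antipode. *)
Lemma gram_comx_anti : M *m K *m S = 1%:M.
Proof.
apply: bilin_inj => a g; rewrite mulmx1.
have -> : (a *m g^T) 0 0 = pr g a by rewrite pairHC pairH_mx.
have lg := linpair g.
have := integral_swap_right hH a L il lg.
rewrite (eq_sw H (G' := fun x y => pr eps x * pr g y)); last first.
  by move=> x y; rewrite mulHL pr_lZL.
rewrite (sw_counitl hH) // => ->.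
rewrite (eq_sw H (G' := fun x y => pr (a *m M) x * pr (g *m S^T) y)).
  by rewrite comxE trmx_mul trmxK !mulmxA.
by move=> x y; rewrite gramE -pairH_mx; congr (_ * _); rewrite !pairH_mx trmx_mul mulmxA.
Qed.

Lemma gramT_comx : M^T *m K = S.
Proof.
apply: bilin_inj => b g.
have -> : (b *m S *m g^T) 0 0 = pr g (antiH H b) by rewrite pairHC pairH_mx.
have lg := linpair g.
have := integral_swap_right hH L b il lg.
rewrite [X in _ = X](eq_sw H (G' := fun x y => pr eps x * pr g (antiH H y))); last first.
  by move=> x y; rewrite mulLH pr_lZL.
rewrite (sw_counitl hH _ (linantiH lg)) => <-.
rewrite (eq_sw H (G' := fun x y => pr (b *m M^T) x * pr g y)).
  by rewrite comxE !mulmxA.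
move=> x y; congr (_ * _); rewrite gramE [RHS]pairHC pairH_mx trmx_mul trmxK.
by rewrite mulmxA.
Qed.

Lemma gram_comxT : M *m K^T = S.
Proof.
apply: bilin_inj => a g.
have -> : (a *m S *m g^T) 0 0 = pr g (antiH H a) by rewrite pairHC pairH_mx.
have lg := linpair g.
have := integral_swap_left hH a L il lg.
rewrite (eq_sw H (G' := fun x y => pr g (antiH H x) * pr eps y)); last first.
  by move=> x y; rewrite mulHL pr_lZL.
rewrite (sw_counitr hH _ (linantiH lg)) => ->.
rewrite (eq_sw H (G' := fun x y => pr g x * pr (a *m M) y)).
  by rewrite comxE [RHS]mx11_tr !trmx_mul !trmxK !mulmxA.
by move=> x y; rewrite gramE -pairH_mx.
Qed.

Lemma antiT_comx_gram : S^T *m K *m M = 1%:M.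
Proof.
apply: bilin_inj => g b; rewrite mulmx1.
rewrite -[RHS]pairH_mx.
have lg := linpair g.
have := integral_swap_left hH L b il lg.
rewrite [X in _ = X](eq_sw H (G' := fun x y => pr g x * pr eps y)); last first.
  by move=> x y; rewrite mulLH pr_lZL.
rewrite (sw_counitr hH _ lg) => <-.
rewrite (eq_sw H (G' := fun x y => pr (g *m S^T) x * pr (b *m M^T) y)).
  by rewrite comxE trmx_mul trmxK !mulmxA.
move=> x y; rewrite gramE; congr (_ * _).
  by rewrite !pairH_mx trmx_mul mulmxA.
by rewrite [RHS]pairHC pairH_mx trmx_mul trmxK mulmxA.
Qed.

Lemma gram_unit : M \in unitmx.
Proof. by case: (mulmx1_unit (etrans (mulmxA _ _ _) gram_comx_anti)). Qed.

Local Notation T := (S *m S).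

(** In terms of elements, l(yx) = l(S^2(x) y): S^2 is the Nakayama automorphism of the Frobenius
    form. *)
Lemma gram_nakayama : M^T = T *m M.
Proof.
have e : K *m S *m M = 1%:M by apply: mulmx1C; rewrite mulmxA gram_comx_anti.
by rewrite -{1}gramT_comx -!mulmxA (mulmxA K) e mulmx1.
Qed.

Lemma gram_nakayama_sym : M = T *m M^T.
Proof.
have e : K^T *m S *m M^T = 1%:M.
  apply: mulmx1C; rewrite -[1%:M]trmx1 -antiT_comx_gram !trmx_mul trmxK.
  by rewrite !mulmxA.
by rewrite -{1}gram_comxT -!mulmxA (mulmxA K^T) e mulmx1.
Qed.

(** The identities from the right swap rule give l(yx) = l(S^2(x) y), those from the left one give
    l(xy) = l(y S^2(x)). Combined, S^4 fixes a nondegenerate form. This is Radford's formula when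
    both integrals are two-sided. *)
Lemma antipode_sqr_invol : T *m T = 1%:M.
Proof.
have e : T *m T *m M = 1%:M *m M.
  by rewrite mul1mx -mulmxA -gram_nakayama -gram_nakayama_sym.
by apply: (row_free_inj _ e); rewrite row_free_unit gram_unit.
Qed.

Lemma gram_inj x y : (forall z, pr l (x ** z) = pr l (y ** z)) -> x = y.
Proof.
move=> e; have : x *m M = y *m M.
  by apply: pairH_inj => z; rewrite !pairH_mx -!gramE e.
by apply: row_free_inj; rewrite row_free_unit gram_unit.
Qed.

Lemma integral_nakayama x b : pr l (x ** b) = pr l (b *m T ** x).
Proof.
rewrite !gramE -(mulmxA b) -gram_nakayama.
by rewrite [RHS]mx11_tr !trmx_mul !trmxK !mulmxA.
Qed.

Lemma antipode_sqrM x y : (x ** y) *m T = (x *m T) ** (y *m T).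
Proof.
apply: gram_inj => z; rewrite -integral_nakayama -(mulHA hH z) integral_nakayama.
by rewrite -(mulHA hH (y *m T)) integral_nakayama -(mulHA hH (x *m T)).
Qed.

Lemma antipode_sqr1 : one *m T = one.
Proof. by apply: gram_inj => z; rewrite -integral_nakayama (mulH1 hH) (mul1H hH). Qed.

(** Writing one factor [S] as [M *m K^T] turns the trace into the sum of p(L_1) l(S(L_2) L_3), and
    the antipode axiom leaves p(L) l(1). *)
Lemma trace_lconv_antipode_sqr p : \tr ((lconv H p)^T *m T) = pr l one * pr p L.
Proof.
rewrite -{2}gram_comxT !mulmxA tr_comx.
transitivity (sw H (fun x y => sw H (fun x1 x2 => pr p x1 * pr l (antiH H x2 ** y)) x) L).
  apply: eq_sw => x y; rewrite !mulmxA -harp_mx -/(antiH H _) -gramE.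
  rewrite (lin_harp (g := fun z => pr l (antiH H z ** y))) // => c u v.
  by rewrite antiHP mulHPl pairHPr.
rewrite (sw_coassoc hH (fun x1 x2 y => pr p x1 * pr l (antiH H x2 ** y))).
transitivity (sw H (fun x y => pr p x * pr eps y) L * pr l one); last first.
  by rewrite (sw_counitr hH _ (linpair p)) mulrC.
rewrite -swZr; apply: eq_sw => x y.
by rewrite swZ (sw_antil hH _ (linpair l)) mulrA.
Qed.

End Frobenius.

(** * The square of the antipode *)

(* E T and T have integral traces, since E T splits along the eigenspaces of T. *)
Lemma involution_pm1 (F : numFieldType) n (E T : 'M[F]_n) (c : F) :
  E *m E = E -> T *m T = 1%:M -> E *m T = T *m E ->
  \tr (E *m T) = c -> \tr T = n%:R * c -> c != 0 -> T = 1%:M \/ T = - 1%:M.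
Proof.
move=> EE TT ET trET trT nzc.
have n2 : (2%:R : F) != 0 by rewrite pnatr_eq0.
pose P := 2%:R^-1 *: (1%:M + T).
have DT : T = 2%:R *: P - 1%:M by rewrite scalerA divff // scale1r addrC addKr.
have PP : P *m P = P.
  have XX : (1%:M + T) *m (1%:M + T) = (1%:M + T) *+ 2.
    by rewrite mulmxDr mulmx1 [X in _ + X]mulmxDl mul1mx TT [T + _]addrC -mulr2n.
  by rewrite /P -scalemxAl -scalemxAr XX -scaler_nat !scalerA -mulrA mulVf // mulr1.
have EP : E *m P = P *m E.
  by rewrite /P -scalemxAl -scalemxAr mulmxDl mulmxDr mul1mx mulmx1 ET.
have EPEP : (E *m P) *m (E *m P) = E *m P.
  by rewrite mulmxA -(mulmxA E P) -EP mulmxA EE -mulmxA PP.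
have t1 : c = 2%:R * (\rank (E *m P))%:R - (\rank E)%:R.
  by rewrite -trET DT mulmxBr mulmx1 -scalemxAr linearB linearZ /= (mxtrace_idem EPEP) (mxtrace_idem EE).
have t2 : n%:R * c = 2%:R * (\rank P)%:R - n%:R.
  by rewrite -trT DT linearB linearZ /= (mxtrace_idem PP) mxtrace1.
have rn : (\rank P <= n)%N := rank_leq_row P.
move: (\rank (E *m P)) (\rank E) t1 => s k t1.
(* With c = 2s - k, the two trace formulas say n (2s - k) = 2 rank P - n. As 2s - k is a nonzero
   integer and rank P <= n, only rank P = 0 or n remains. The subtractions are cleared to state this
   in natural numbers. *)
have e : (n * (2 * s) + n = 2 * \rank P + n * k)%N.
  apply/eqP; rewrite -(eqr_nat F) !natrD !natrM; apply/eqP.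
  have := t2; rewrite t1 => t2'; apply: (addIr (- n%:R - n%:R * k%:R)).
  transitivity (n%:R * (2%:R * s%:R - k%:R) : F); first by ring.
  by rewrite t2'; ring.
have nk : (2 * s <> k)%N by move=> h; move/eqP: nzc; rewrite t1 -h natrM subrr.
have [r0|rf] : \rank P = 0%N \/ \rank P = n by nia.
  right; move/eqP: r0; rewrite mxrank_eq0 => /eqP P0.
  by rewrite DT P0 scaler0 sub0r.
left; have P1 : P = 1%:M.
  have rfP : row_free P by rewrite /row_free rf.
  by apply: (row_free_inj rfP); rewrite /= PP mul1mx.
by rewrite DT P1 scaler_nat mulr2n addrK.
Qed.

Section AntipodeSquare.
Variables (C : numClosedFieldType) (d : nat) (H : hopf_data C d) (l L : 'rV[C]_d).
Hypotheses (hH : is_hopf H) (il : integralHdual H l) (iL : integralH H L)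
  (lL : pairH l L = 1) (l1 : pairH l (hunit H) = d%:R) (ss : semisimpleH H).
Implicit Types (a b x y h p q : 'rV[C]_d).
Local Notation e_ := (ebas C).
Local Notation "x ** y" := (mulH H x y) (at level 40, left associativity).
Local Notation pr := (@pairH C d).
Local Notation S := (hanti H).
Local Notation one := (hunit H).
Local Notation eps := (epsH H).
Local Notation T := (S *m S).

Lemma convH_lconv p q : convH H p q = q *m lconv H p.
Proof.
by apply: pairH_inj => x; rewrite -pairH_harp harp_mx !pairH_mx trmx_mul trmxK mulmxA.
Qed.

Lemma mulH_lmulmx k x : x *m lmulmx H k = e_ k ** x.
Proof.
apply/rowP => c; rewrite mulH_ebasl mxE; apply: eq_bigr => b _.
by rewrite mxE.
Qed.

Lemma hunit_neq0 : one != 0.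
Proof.
apply/negP => /eqP e; have := eps_unit hH; rewrite e pairHC /pairH big1 => [/esym/eqP|k _].
  by rewrite oner_eq0.
by rewrite mxE mul0r.
Qed.

(** Maschke's criterion. A left ideal [J] complementary to the augmentation ideal contains some x
    with eps(x) != 0. Since h x - eps(h) x lies in both ideals, h x = eps(h) x; then eps(L) x = L x
    = eps(x) L, which is nonzero. *)
Lemma eps_integral_neq0 : pr eps L != 0.
Proof.
pose I := kermx (eps^T).
have inI x : (x <= I)%MS = (pr eps x == 0).
  rewrite /I pairHC pairH_mx; apply/sub_kermxP/eqP => [->|e]; first by rewrite mxE.
  by apply/matrixP => i j; rewrite !ord1 e mxE.
have Iid : left_idealH H I.
  move=> k; apply/row_subP => i; rewrite row_mul inI mulH_lmulmx (eps_mul hH).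
  by have := row_sub i I; rewrite inI => /eqP ->; rewrite mulr0.
have [J [Jid IJ0 IJf]] := ss Iid.
have [i nzx] : exists i, pr eps (row i J) != 0.
  apply/existsP; rewrite -negb_forall; apply/negP => /forallP h.
  have JI : (J <= I)%MS by apply/row_subP => i; rewrite inI h.
  have : (one <= I)%MS.
    apply: submx_trans (_ : (I + J <= I)%MS); last by rewrite addsmx_sub submx_refl.
    exact: submx_full.
  by rewrite inI (eps_unit hH) oner_eq0.
set x := row i J in nzx.
have xJ : (x <= J)%MS by exact: row_sub.
have ax k : e_ k ** x = pr eps (e_ k) *: x.
  apply/eqP; rewrite -subr_eq0 -submx0; apply: submx_trans (_ : (I :&: J <= 0)%MS).
    rewrite sub_capmx; apply/andP; split.
      rewrite inI -scaleN1r addrC pairHPr (linZ _ _ (linpair eps)) (eps_mul hH).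
      by rewrite mulN1r addNr.
    rewrite addmx_sub //.
      by rewrite -mulH_lmulmx (submx_trans _ (Jid k)) // submxMr.
    by rewrite -scaleN1r !scalemx_sub.
  by rewrite submx0.
have Lx : L ** x = pr eps L *: x.
  rewrite mulH_rmx {1}(row_sum_delta L) mulmx_suml /pairH scaler_suml.
  apply: eq_bigr => k _; rewrite -scalemxAl -mulH_rmx ax scalerA pairH_ebas mulrC.
  by [].
have := mulLH iL x; rewrite Lx => e.
apply: contra nzx => /eqP z; move: e; rewrite z scale0r => /esym/eqP.
rewrite scaler_eq0 => /orP[] // /eqP L0; have := lL.
by rewrite L0 (_ : pr l 0 = 0) => [/esym/eqP|]; rewrite ?oner_eq0 // -(scale0r 0) (linZ _ _ (linpair l)) mul0r.
Qed.

Definition chireg : 'rV[C]_d := \row_k \tr (lmx H (e_ k)).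

Lemma lmxE x y : y *m lmx H x = x ** y. Proof. by rewrite mulH_lmx. Qed.

Lemma lmxP c x y : lmx H (c *: x + y) = c *: lmx H x + lmx H y.
Proof.
apply/row_matrixP => i; rewrite linearD linearZ /= !rowE !lmxE mulHPl.
by [].
Qed.

Lemma chiregE x : pr chireg x = \tr (lmx H x).
Proof.
rewrite (linE x (linpair _)) (linE (g := fun x => \tr (lmx H x)) x) => [|c u v].
  by apply: eq_bigr => k _; rewrite pairH_ebas mxE.
by rewrite lmxP linearD linearZ.
Qed.

Lemma tr_lmx x : \tr (lmx H x) = \sum_j (x ** e_ j) 0 j.
Proof. by apply: eq_bigr => j _; rewrite -lmxE /ebas -rowE [RHS]mxE. Qed.

Lemma lmxM x y : lmx H (x ** y) = lmx H y *m lmx H x.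
Proof.
by apply/row_matrixP => i; rewrite !rowE mulmxA !lmxE (mulHA hH).
Qed.

Lemma lincoord j : lin (fun x => x 0 j).
Proof. by move=> c x y; rewrite !mxE. Qed.

(* H (x) V is a free module of rank dim V; the antipode enters through the
   isomorphism with H (x) V_triv, whose effect on traces is computed directly. *)
Lemma chireg_absorb chi : (forall x y, pr chi (x ** y) = pr chi (y ** x)) ->
  convH H chireg chi = pr chi one *: chireg.
Proof.
move=> tchi; apply: pairH_inj => h.
rewrite pairH_conv [RHS]pairHC (linZ _ _ (linpair h)) [pr h _]pairHC chiregE tr_lmx.
transitivity (\sum_j sw H (fun h1 h2 => (h1 ** e_ j) 0 j * pr chi h2) h).
  rewrite -sw_sum; apply: eq_sw => x y; by rewrite chiregE tr_lmx mulr_suml.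
transitivity (\sum_j \sum_k sw H (fun x' x3 => (h ** x') 0 k *
     sw H (fun y1 y2 => y1 0 j * pr chi (y2 ** antiH H x3)) (e_ k)) (e_ j)).
  apply: eq_bigr => j _; rewrite (sw_mul_antir hH _ _ (lincoord j) (linpair chi)).
  rewrite -sw_sum; apply: eq_sw => x y; exact: swE.
rewrite exchange_big mulr_sumr; apply: eq_bigr => k _ /=.
transitivity (\sum_j sw H (fun y1 y2 => y1 0 j * sw H (fun x' x3 =>
   (h ** x') 0 k * pr chi (y2 ** antiH H x3)) (e_ j)) (e_ k)).
  apply: eq_bigr => j _.
  transitivity (sw H (fun x' x3 => sw H (fun y1 y2 => (h ** x') 0 k * (y1 0 j * pr chi (y2 ** antiH H x3))) (e_ k)) (e_ j)).
    by apply: eq_sw => x y; rewrite swZ.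
  rewrite sw_exchange; apply: eq_sw => x y; rewrite -swZ; apply: eq_sw => u v; ring.
rewrite -sw_sum.
transitivity (sw H (fun y1 y2 => sw H (fun x' x3 =>
   (h ** x') 0 k * pr chi (y2 ** antiH H x3)) y1) (e_ k)).
  by apply: eq_sw => x y; rewrite [RHS]swE.
rewrite (sw_coassoc hH (fun x' x3 y2 => (h ** x') 0 k * pr chi (y2 ** antiH H x3))).
(* Cyclicity of [chi] turns chi(v S(u)) into chi(S(u) v), the order in which the antipode axiom
   applies. *)
transitivity (sw H (fun x y => (h ** x) 0 k * pr chi one * pr eps y) (e_ k)).
  apply: eq_sw => x y; rewrite swZ -mulrA; congr (_ * _).
  rewrite mulrC -(sw_antil hH _ (linpair chi)); apply: eq_sw => u v; exact: tchi.
rewrite (sw_counitr hH (g := fun x => (h ** x) 0 k * pr chi one)) 1?mulrC // => c u v.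
by rewrite mulHPr lincoord; ring.
Qed.

Lemma d_neq0 : (d%:R : C) != 0.
Proof.
rewrite pnatr_eq0; apply/eqP => d0; have := lL; rewrite /pairH big1 => [/esym/eqP|k].
  by rewrite oner_eq0.
by move: (ltn_ord k); rewrite {2}d0.
Qed.

Lemma chireg_tr x y : pr chireg (x ** y) = pr chireg (y ** x).
Proof. by rewrite !chiregE !lmxM mxtrace_mulC. Qed.

Lemma chireg1 : pr chireg one = d%:R.
Proof.
rewrite chiregE (_ : lmx H one = 1%:M) ?mxtrace1 //.
by apply/row_matrixP => i; rewrite !rowE lmxE (mul1H hH) mulmx1.
Qed.

(** S^2 is an algebra automorphism, so left multiplication by S^2(x) is conjugate to left
    multiplication by x and has the same trace. *)
Lemma chireg_antipode_sqr : chireg *m T^T = chireg.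
Proof.
have TT := antipode_sqr_invol hH il iL lL.
have TM := antipode_sqrM hH il iL lL.
set U := T in TT TM *; clearbody U; apply: pairH_inj => x.
have -> : pr (chireg *m U^T) x = pr chireg (x *m U).
  by rewrite !pairH_mx trmx_mul mulmxA.
rewrite !chiregE (_ : lmx H (x *m U) = U *m lmx H x *m U).
  by rewrite mxtrace_mulC mulmxA TT mul1mx.
apply/row_matrixP => i; rewrite !rowE !mulmxA lmxE lmxE.
by rewrite TM -(mulmxA _ U U) TT mulmx1.
Qed.

Lemma lmx_integral : lmx H L = eps^T *m L.
Proof.
apply/row_matrixP => i; rewrite !rowE lmxE (mulLH iL) mulmxA.
by rewrite [delta_mx 0 i *m _]mx11_scalar mul_scalar_mx -pairH_mx pairHC.
Qed.

Lemma lconv_eps : lconv H eps = 1%:M.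
Proof.
by apply/row_matrixP => i; rewrite !rowE -convH_lconv (conv1H hH) mulmx1.
Qed.

Lemma convH_antipode_sqr p q : convH H p q *m T^T = convH H (p *m T^T) (q *m T^T).
Proof.
have := antipode_sqrM (is_hopf_dual hH) (integral_dual iL) (dual_integral il) _ p q.
rewrite -!convHE /= trmx_mul; apply.
by rewrite pairHC lL.
Qed.

Lemma lconvM p q : lconv H (convH H p q) = lconv H q *m lconv H p.
Proof.
by apply/row_matrixP => i; rewrite !rowE mulmxA -!convH_lconv (convHA hH).
Qed.

Lemma convZl c p q : convH H (c *: p) q = c *: convH H p q.
Proof. by rewrite !convHE !mulH_rmx -scalemxAl. Qed.

Lemma convZr c p q : convH H p (c *: q) = c *: convH H p q.
Proof. by rewrite !convH_lconv -scalemxAl. Qed.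

(* Larson-Radford: for the idempotent e = chireg / d, eps(L) is the trace of the
   antipode squared on e H^*, hence an integer, while d eps(L) is its trace on
   all of H. *)
Lemma antipode_sqr_eps : T = 1%:M /\ pr eps L = 1.
Proof.
have nd := d_neq0.
pose e := d%:R^-1 *: chireg.
have ee : convH H e e = e.
  by rewrite convZl convZr (chireg_absorb chireg_tr) chireg1 !scalerA mulfVK.
have eT : e *m T^T = e by rewrite -scalemxAl chireg_antipode_sqr.
have EE : (lconv H e)^T *m (lconv H e)^T = (lconv H e)^T.
  by rewrite -trmx_mul -lconvM ee.
have ET : (lconv H e)^T *m T = T *m (lconv H e)^T.
  rewrite -[T in LHS]trmxK -[T in RHS]trmxK -trmx_mul -[RHS]trmx_mul; congr trmx.
  apply/row_matrixP => i; rewrite !rowE !mulmxA -convH_lconv -[in RHS]convH_lconv.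
  by rewrite convH_antipode_sqr eT.
(* The trace formula gives d <e, L> = chireg(L), the trace of the rank one map x -> eps(x) L. *)
have tE : \tr ((lconv H e)^T *m T) = pr eps L.
  rewrite (trace_lconv_antipode_sqr hH il iL lL) l1 pairHC (linZ _ _ (linpair L)) mulrA divff // mul1r.
  by rewrite pairHC chiregE lmx_integral mxtrace_mulC trace_mx11 -pairH_mx pairHC.
have tT : \tr T = d%:R * pr eps L.
  by rewrite -l1 -(trace_lconv_antipode_sqr hH il iL lL) lconv_eps trmx1 mul1mx.
have T1 : T = 1%:M.
  (* S^2 = -1 is impossible because S^2 fixes the unit. *)
  have [//|T1] := involution_pm1 EE (antipode_sqr_invol hH il iL lL) ET tE tT eps_integral_neq0.
  have := antipode_sqr1 hH il iL lL; rewrite T1 mulmxN mulmx1 => /eqP.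
  rewrite eq_sym -addr_eq0 -mulr2n -scaler_nat scaler_eq0 pnatr_eq0 /=.
  by rewrite (negbTE hunit_neq0).
split=> //; move: tT; rewrite T1 mxtrace1 -{1}[d%:R]mulr1 => /(mulfI nd).
by [].
Qed.

Lemma integral_sym x y : pr l (x ** y) = pr l (y ** x).
Proof.
by rewrite (integral_nakayama hH il iL lL) (proj1 antipode_sqr_eps) mulmx1.
Qed.

Lemma tr_lconv p : \tr (lconv H p) = d%:R * pr p L.
Proof.
rewrite -l1 -(trace_lconv_antipode_sqr hH il iL lL) (proj1 antipode_sqr_eps).
by rewrite mulmx1 mxtrace_tr.
Qed.

Lemma lconv_dual x : lconv (dualH H) x = lmx H x.
Proof. by apply/matrixP => b c; rewrite [LHS]mxE mulH_dual mulH_ebasr [RHS]mxE. Qed.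

(** The trace formula for the dual Hopf algebra, in which [l] and [L] change roles; its constant is
    eps(L) = 1. Hence lambda is the regular character of H. *)
Lemma integral_chireg x : pr l x = \tr (lmx H x).
Proof.
have := trace_lconv_antipode_sqr (is_hopf_dual hH) (integral_dual iL) (dual_integral il) _ x.
rewrite /= -trmx_mul (proj1 antipode_sqr_eps) trmx1 mulmx1 mxtrace_tr lconv_dual.
move/(_ (etrans (pairHC _ _) lL)) => ->.
by rewrite [pr L _]pairHC (proj2 antipode_sqr_eps) mul1r pairHC.
Qed.

Lemma conv_integral_sym p q : pr (convH H p q) L = pr (convH H q p) L.
Proof.
have := integral_nakayama (is_hopf_dual hH) (integral_dual iL) (dual_integral il) _ p q.
rewrite /= -trmx_mul (proj1 antipode_sqr_eps) trmx1 mulmx1 -!convHE ![pr L _]pairHC; apply.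
exact: lL.
Qed.

End AntipodeSquare.

(** * Representations and their characters *)

(** In a basis adapted to U, each X preserving U is block triangular; [g1] and [g2] read off the
    action on U and on the quotient. They are bundled linear maps so that they commute with the sums
    in the definition of a representation. *)
Lemma stable_split (F : fieldType) n (U : 'M[F]_n) : (0 < \rank U)%N -> (\rank U < n)%N ->
  exists n1 n2 (g1 : {linear 'M[F]_n -> 'M[F]_n1}) (g2 : {linear 'M[F]_n -> 'M[F]_n2}),
  [/\ (n1 < n)%N, (n2 < n)%N, g1 1%:M = 1%:M /\ g2 1%:M = 1%:M,
    forall X, (U *m X <= U)%MS -> \tr X = \tr (g1 X) + \tr (g2 X) &
    forall X Y, (U *m X <= U)%MS -> (U *m Y <= U)%MS ->
      g1 (X *m Y) = g1 X *m g1 Y /\ g2 (X *m Y) = g2 X *m g2 Y].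
Proof.
move=> U0 Un.
pose P := col_mx (row_base U) (row_base U^C%MS).
have full : row_full P.
  rewrite -sub1mx; have : (1%:M <= U + U^C)%MS by rewrite sub1mx addsmx_compl_full.
  have -> : (1%:M <= U + U^C)%MS = (1%:M <= row_base U + row_base U^C)%MS.
    by rewrite (adds_eqmx (eq_row_base U) (eq_row_base U^C%MS)).
  by rewrite addsmxE.
have sz : (\rank U + \rank U^C%MS = n)%N by rewrite mxrank_compl subnKC // rank_leq_row.
have free : row_free P by rewrite /row_free (eqP full) sz.
have [Q QP] := row_fullP full.
have [Q' PQ'] := row_freeP free.
have PQ : P *m Q = 1%:M.
  by rewrite -PQ' -[Q']mul1mx -QP -(mulmxA Q) PQ' mulmx1.
have f_lin : linear (fun X : 'M[F]_n => P *m X *m Q).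
  by move=> a X Y; rewrite mulmxDr mulmxDl -scalemxAr -scalemxAl.
have g1_lin : linear (fun X : 'M[F]_n => ulsubmx (P *m X *m Q)).
  by move=> a X Y; rewrite f_lin; apply/matrixP => i j; rewrite !mxE.
have g2_lin : linear (fun X : 'M[F]_n => drsubmx (P *m X *m Q)).
  by move=> a X Y; rewrite f_lin; apply/matrixP => i j; rewrite !mxE.
pose L1 := GRing.isLinear.Build F 'M[F]_n 'M[F]_(\rank U) *:%R _ g1_lin.
pose L2 := GRing.isLinear.Build F 'M[F]_n 'M[F]_(\rank U^C%MS) *:%R _ g2_lin.
pose g1 : {linear _ -> _} := HB.pack (fun X : 'M[F]_n => ulsubmx (P *m X *m Q)) L1.
pose g2 : {linear _ -> _} := HB.pack (fun X : 'M[F]_n => drsubmx (P *m X *m Q)) L2.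
have blk X : (U *m X <= U)%MS -> exists A, P *m X *m Q = block_mx (g1 X) 0 A (g2 X).
  move=> st; exists (dlsubmx (P *m X *m Q)).
  rewrite -[LHS]submxK; congr (block_mx _ _ _ _).
  have : (row_base U *m X <= row_base U)%MS.
    by rewrite eq_row_base (submx_trans _ st) // submxMr // eq_row_base.
  case/submxP => Y eY.
  have -> : ursubmx (P *m X *m Q) = rsubmx (row_base U *m X *m Q).
    by rewrite /ursubmx -!mul_usub_mx /P col_mxKu.
  have bQ : row_base U *m Q = row_mx 1%:M 0.
    have := congr1 usubmx PQ; rewrite -mul_usub_mx {1}/P col_mxKu => ->.
    by rewrite scalar_mx_block /block_mx col_mxKu.
  by rewrite eY -mulmxA bQ mul_mx_row mulmx0 row_mxKr.
exists (\rank U), (\rank U^C%MS), g1, g2; split=> //.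
- by rewrite mxrank_compl ltn_subrL U0 (leq_ltn_trans _ Un).
- by rewrite /g1 /g2 /= mulmx1 PQ scalar_mx_block block_mxKul block_mxKdr.
- move=> X st; have [A e] := blk X st.
  by rewrite -(mxtrace_block (g1 X) 0 A (g2 X)) -e mxtrace_mulC mulmxA QP mul1mx.
- move=> X Y stX stY; have [A e] := blk X stX; have [B e'] := blk Y stY.
  have stXY : (U *m (X *m Y) <= U)%MS.
    by rewrite mulmxA (submx_trans _ stY) // submxMr.
  have [D e''] := blk _ stXY.
  have : P *m (X *m Y) *m Q = (P *m X *m Q) *m (P *m Y *m Q).
    by rewrite !mulmxA -(mulmxA _ Q P) QP mulmx1.
  rewrite e e' e'' mulmx_block => /eq_block_mx [-> _ _ ->].
  by rewrite !mul0mx !mulmx0 addr0 add0r.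
Qed.

Section Representations.
Variables (C : numClosedFieldType) (d : nat) (H : hopf_data C d).
Implicit Types (a b x y h p q : 'rV[C]_d).
Local Notation e_ := (ebas C).
Local Notation "x ** y" := (mulH H x y) (at level 40, left associativity).
Local Notation pr := (@pairH C d).
Local Notation one := (hunit H).
Local Notation eps := (epsH H).

(* Cutting along an eigenspace of Z, which is a subrepresentation, reduces to Z
   scalar. *)
Lemma trace_in_RH RH : is_RH H RH -> forall n (rho : 'I_d -> 'M[C]_n) (Z : 'M[C]_n),
  is_rep H rho -> (forall k, Z *m rho k = rho k *m Z) ->
  (\row_k \tr (Z *m rho k) <= RH)%MS.
Proof.
move=> [RHc _]; elim/ltn_ind => n IH rho Z [ru rm] cZ.
case: (posnP n) => [n0|n0].
  rewrite (_ : \row_k _ = 0) ?sub0mx //; apply/rowP => k; rewrite !mxE.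
  by apply: big1 => i; move: (ltn_ord i); rewrite {2}n0.
have split (U : 'M[C]_n) : U != 0 -> ~~ row_full U -> (forall k, (U *m (rho k)^T <= U)%MS) ->
    (U *m Z^T <= U)%MS -> (\row_k \tr (Z *m rho k) <= RH)%MS.
  move=> U0 Uf Ur UZ.
  have [||n1 [n2 [g1 [g2 [l1 l2 [g11 g21] gt gM]]]]] := stable_split (U := U).
  - by rewrite lt0n mxrank_eq0.
  - by rewrite ltn_neqAle rank_leq_row andbT.
  have rep1 (m : nat) (g : {linear 'M[C]_n -> 'M[C]_m}) : g 1%:M = 1%:M ->
     (forall X Y, (U *m X <= U)%MS -> (U *m Y <= U)%MS -> g (X *m Y) = g X *m g Y) ->
     is_rep H (fun k => (g (rho k)^T)^T) /\
     (forall k, (g Z^T)^T *m (g (rho k)^T)^T = (g (rho k)^T)^T *m (g Z^T)^T).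
    move=> g1' gM'; split; last first.
      by move=> k; rewrite -!trmx_mul -!gM' // -!trmx_mul cZ.
    split.
      rewrite -[RHS]trmx1 -g1' -(trmx1 C n) -ru !raddf_sum; apply: eq_bigr => k _ /=.
      by rewrite !linearZ.
    move=> i j; rewrite -trmx_mul -gM' // -trmx_mul rm !raddf_sum; apply: eq_bigr => k _ /=.
    by rewrite !linearZ.
  have [r1 c1] := rep1 _ g1 g11 (fun X Y hX hY => proj1 (gM X Y hX hY)).
  have [r2 c2] := rep1 _ g2 g21 (fun X Y hX hY => proj2 (gM X Y hX hY)).
  have -> : \row_k \tr (Z *m rho k) = \row_k \tr ((g1 Z^T)^T *m (g1 (rho k)^T)^T)
     + \row_k \tr ((g2 Z^T)^T *m (g2 (rho k)^T)^T).
    apply/rowP => k; rewrite !mxE -(mxtrace_tr (Z *m _)) trmx_mul gt; last first.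
      by rewrite mulmxA (submx_trans _ UZ) // submxMr.
    have [-> ->] := gM _ _ (Ur k) UZ.
    by rewrite -!trmx_mul !mxtrace_tr.
  by rewrite addmx_sub // IH.
have [r [_ Dp]] := mxtrace_eigen Z^T.
have [v vZ nzv] := char_poly_root_eigen Dp (Ordinal n0).
set al := r _ in vZ.
pose K := eigenspace Z^T al.
have vK : (v <= K)%MS by apply/eigenspaceP.
have K0 : K != 0 by apply: contra nzv => /eqP K0; rewrite -submx0 -K0.
have KZ : (K *m Z^T <= K)%MS.
  have /eigenspaceP -> : (K <= eigenspace Z^T al)%MS by [].
  exact: scalemx_sub.
have Kr k : (K *m (rho k)^T <= K)%MS.
  apply/eigenspaceP; rewrite -mulmxA -trmx_mul cZ trmx_mul mulmxA.
  have /eigenspaceP -> : (K <= eigenspace Z^T al)%MS by [].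
  by rewrite scalemxAl.
have [Kf|] := boolP (row_full K); last by move=> Kf; apply: (split K).
have Za : Z = al%:M.
  have : (1%:M <= K)%MS by rewrite sub1mx.
  by move/eigenspaceP; rewrite mul1mx scalemx1 => /(congr1 trmx); rewrite trmxK tr_scalar_mx.
have [ir|nir] := Classical_Prop.classic (irr_rep H rho).
  rewrite (_ : \row_k _ = al *: \row_k \tr (rho k)).
    by rewrite scalemx_sub //; apply: RHc; exists n, rho.
  by apply/rowP => k; rewrite !mxE Za mul_scalar_mx mxtraceZ.
have [[U [stU U0 Uf]]|no] := Classical_Prop.classic (exists U : 'M[C]_n,
   [/\ (forall k, (U *m (rho k)^T <= U)%MS), U != 0 & ~~ row_full U]).
  apply: (split U) => //; rewrite Za tr_scalar_mx mul_mx_scalar; exact: scalemx_sub.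
exfalso; apply: nir; split=> // U stU.
have [->|U0] := eqVneq U 0; [by left | right].
by apply: contraT => Uf; exfalso; apply: no; exists U.
Qed.

Definition rep n (rho : 'I_d -> 'M[C]_n) x : 'M[C]_n := \sum_k x 0 k *: rho k.

Lemma repP n (rho : 'I_d -> 'M[C]_n) c x y : rep rho (c *: x + y) = c *: rep rho x + rep rho y.
Proof.
rewrite /rep scaler_sumr -big_split; apply: eq_bigr => k _ /=.
by rewrite !mxE scalerDl scalerA.
Qed.

Lemma rep_ebas n (rho : 'I_d -> 'M[C]_n) k : rep rho (e_ k) = rho k.
Proof.
rewrite /rep (bigD1 k) //= big1 => [|i ik]; first by rewrite mxE !eqxx scale1r addr0.
by rewrite mxE (negbTE ik) andbF scale0r.
Qed.

Lemma lin_rep n (rho : 'I_d -> 'M[C]_n) i j : lin (fun x => rep rho x i j).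
Proof. by move=> c x y; rewrite repP !mxE. Qed.

Lemma pairH_char n (rho : 'I_d -> 'M[C]_n) x : pr (\row_k \tr (rho k)) x = \tr (rep rho x).
Proof.
rewrite /rep raddf_sum /pairH; apply: eq_bigr => k _ /=; by rewrite mxE mxtraceZ mulrC.
Qed.

Lemma repM n (rho : 'I_d -> 'M[C]_n) x y : is_rep H rho -> rep rho (x ** y) = rep rho x *m rep rho y.
Proof.
move=> [_ rm]; rewrite /rep mulmx_suml.
transitivity (\sum_a \sum_b \sum_c (x 0 a * y 0 b * hmul H a b c) *: rho c).
  under eq_bigr => c _ do rewrite mxE scaler_suml.
  rewrite exchange_big; apply: eq_bigr => a _ /=; under eq_bigr => c _ do rewrite scaler_suml.
  by rewrite exchange_big.
apply: eq_bigr => a _; rewrite mulmx_sumr; apply: eq_bigr => b _.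
rewrite -scalemxAl -scalemxAr rm scalerA scaler_sumr; apply: eq_bigr => c _.
by rewrite scalerA.
Qed.

Lemma rep1 n (rho : 'I_d -> 'M[C]_n) : is_rep H rho -> rep rho one = 1%:M.
Proof. by case. Qed.

Lemma is_repP n (rho : 'I_d -> 'M[C]_n) : rep rho one = 1%:M ->
  (forall x y, rep rho (x ** y) = rep rho x *m rep rho y) -> is_rep H rho.
Proof.
move=> r1 rM; split=> // a b; rewrite -(rep_ebas rho a) -(rep_ebas rho b) -rM.
by apply: eq_bigr => c _; rewrite mulH_ebas.
Qed.

Hypothesis hH : is_hopf H.

Lemma char_tr n (rho : 'I_d -> 'M[C]_n) x y : is_rep H rho ->
  pr (\row_k \tr (rho k)) (x ** y) = pr (\row_k \tr (rho k)) (y ** x).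
Proof. by move=> hr; rewrite !pairH_char !repM // mxtrace_mulC. Qed.

(* A matrix coefficient carries an eigenvector of rho(h) to one of left
   multiplication by h on H, so the eigenvalues of rho(h) range in a finite set
   independent of rho. *)
Lemma rep_eigen_bound h : exists2 c : C, 0 <= c & forall n (rho : 'I_d -> 'M[C]_n),
  is_rep H rho -> `|\tr (rep rho h)| <= n%:R * c.
Proof.
have [r [_ Dp]] := mxtrace_eigen (lmx H h)^T.
exists (\sum_i `|r i|) => [|n rho hr]; first by apply: sumr_ge0.
have [s [-> Ds]] := mxtrace_eigen (rep rho h).
apply: le_trans (ler_norm_sum _ _ _) _.
rewrite mulr_natl -[X in _ <= _ *+ X](card_ord n) -sumr_const.
apply: ler_sum => i _; have [w wh nzw] := char_poly_root_eigen Ds i.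
have [j nzj] : exists j, w 0 j != 0 by case/rV0Pn: nzw => j; exists j.
pose p := \row_k (w *m rho k) 0 j.
have pE x : pr p x = (w *m rep rho x) 0 j.
  rewrite /rep mulmx_sumr summxE; apply: eq_bigr => k _.
  by rewrite -scalemxAr !mxE mulrC.
have : eigenvalue (lmx H h)^T (s i).
  apply/eigenvalueP; exists p.
    apply: pairH_inj => x; rewrite [RHS]pairHC (linZ _ _ (linpair x)) [pr x _]pairHC.
    have -> : pr (p *m (lmx H h)^T) x = pr p (h ** x).
      by rewrite !pairH_mx -lmxE trmx_mul mulmxA.
    by rewrite !pE repM // mulmxA wh -scalemxAl mxE.
  apply: contra nzj => /eqP p0; have := pE one; rewrite (rep1 hr) mulmx1 => <-.
  by rewrite p0 pairHC -(scale0r 0) (linZ _ _ (linpair _)) mul0r.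
rewrite eigenvalue_root_char Dp /root horner_prod prodf_seq_eq0 => /hasP[k _ /=].
rewrite !hornerE subr_eq0 => /eqP ->.
by rewrite (bigD1 k) //= lerDl sumr_ge0.
Qed.

Lemma rep_bound : exists2 K : C, 0 <= K & forall n (rho : 'I_d -> 'M[C]_n),
  is_rep H rho -> forall k, `|\tr (rho k)| <= n%:R * K.
Proof.
have ex : forall k : 'I_d, exists c : C, 0 <= c /\ forall n (rho : 'I_d -> 'M[C]_n),
    is_rep H rho -> `|\tr (rho k)| <= n%:R * c.
  move=> k; have [c c0 hc] := rep_eigen_bound (e_ k); exists c; split=> // n rho hr.
  by rewrite -rep_ebas; apply: hc.
have [f hf] := fin_all_exists ex.
exists (\sum_k f k) => [|n rho hr k]; first by apply: sumr_ge0 => k _; case: (hf k).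
apply: le_trans (proj2 (hf k) n rho hr) _; apply: ler_wpM2l => //.
by rewrite (bigD1 k) //= lerDl sumr_ge0 // => i _; case: (hf i).
Qed.

Lemma mxtrace_tens (R : comPzRingType) m n (A : 'M[R]_m) (B : 'M[R]_n) :
  \tr (A *t B) = \tr A * \tr B.
Proof.
rewrite /mxtrace mulr_suml.
under [RHS]eq_bigr => i _ do rewrite mulr_sumr.
rewrite pair_bigA (reindex (@mxtens_index m n)) /=; last first.
  by exists (@mxtens_unindex m n) => i _; rewrite ?mxtens_indexK ?mxtens_unindexK.
by apply: eq_bigr => -[i j] _; rewrite tensmxE.
Qed.

Definition tensrep m n (r1 : 'I_d -> 'M[C]_m) (r2 : 'I_d -> 'M[C]_n) c : 'M[C]_(m * n) :=
  \sum_a \sum_b hcomul H c a b *: (r1 a *t r2 b).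

Lemma tensrepE m n (r1 : 'I_d -> 'M[C]_m) (r2 : 'I_d -> 'M[C]_n) x i j :
  rep (tensrep r1 r2) x i j = sw H (fun u v => (rep r1 u *t rep r2 v) i j) x.
Proof.
rewrite swE /rep summxE; apply: eq_bigr => c _; rewrite mxE sw_ebas; congr (_ * _).
rewrite summxE; apply: eq_bigr => a _; rewrite summxE; apply: eq_bigr => b _.
by rewrite mxE -!/(rep _ _) !rep_ebas.
Qed.

Lemma tensrep_is_rep m n (r1 : 'I_d -> 'M[C]_m) (r2 : 'I_d -> 'M[C]_n) :
  is_rep H r1 -> is_rep H r2 -> is_rep H (tensrep r1 r2).
Proof.
move=> h1 h2.
have ll (i j : 'I_(m * n)) v : lin (fun u => (rep r1 u *t rep r2 v) i j).
  case: (mxtens_indexP i) => i1 i2; case: (mxtens_indexP j) => j1 j2 c x y.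
  by rewrite !tensmxE lin_rep; ring.
have lr (i j : 'I_(m * n)) u : lin (fun v => (rep r1 u *t rep r2 v) i j).
  case: (mxtens_indexP i) => i1 i2; case: (mxtens_indexP j) => j1 j2 c x y.
  by rewrite !tensmxE lin_rep; ring.
apply: is_repP => [|x y]; apply/matrixP => i j; rewrite tensrepE.
  rewrite (sw_unit hH) // (rep1 h1) (rep1 h2).
  case: (mxtens_indexP i) => i1 i2; case: (mxtens_indexP j) => j1 j2.
  by rewrite tensmxE !mxE (can_eq (@mxtens_indexK m n)) -natrM mulnb.
rewrite (sw_mul hH) //.
transitivity (sw H (fun x1 x2 => sw H (fun y1 y2 =>
   \sum_k (rep r1 x1 *t rep r2 x2) i k * (rep r1 y1 *t rep r2 y2) k j) y) x).
  apply: eq_sw => x1 x2; apply: eq_sw => y1 y2.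
  by rewrite !repM // -tensmx_mul mxE.
rewrite mxE.
transitivity (sw H (fun x1 x2 => \sum_k (rep r1 x1 *t rep r2 x2) i k * rep (tensrep r1 r2) y k j) x).
  apply: eq_sw => x1 x2; rewrite sw_sum; apply: eq_bigr => k _; by rewrite swZ tensrepE.
by rewrite sw_sum; apply: eq_bigr => k _; rewrite swZr -tensrepE.
Qed.

Lemma tensrep_char m n (r1 : 'I_d -> 'M[C]_m) (r2 : 'I_d -> 'M[C]_n) :
  \row_k \tr (tensrep r1 r2 k) = convH H (\row_k \tr (r1 k)) (\row_k \tr (r2 k)).
Proof.
apply/rowP => c; rewrite !mxE /tensrep raddf_sum; apply: eq_bigr => a _ /=.
rewrite raddf_sum; apply: eq_bigr => b _ /=.
by rewrite mxtraceZ mxtrace_tens !mxE mulrA.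
Qed.

Lemma conv_pow_char n (rho : 'I_d -> 'M[C]_n) k : is_rep H rho ->
  exists r : 'I_d -> 'M[C]_(n ^ k), is_rep H r /\
    iter k (convH H (\row_k \tr (rho k))) eps = \row_k \tr (r k).
Proof.
move=> hr; elim: k => [|k [r [hr' IH]]].
  exists (fun k => (hcounit H k)%:M); split; last first.
    by apply/rowP => k; rewrite !mxE mxtrace_scalar.
  have rE x : rep (fun k => (hcounit H k)%:M) x = (pr eps x)%:M :> 'M[C]_(n ^ 0).
    rewrite /rep /pairH raddf_sum; apply: eq_bigr => k _ /=.
    by rewrite scale_scalar_mx mxE mulrC.
  apply: is_repP => [|x y]; first by rewrite rE (eps_unit hH).
  by rewrite !rE (eps_mul hH) -scalar_mxM.
have e : (n * n ^ k = n ^ k.+1)%N by rewrite expnS.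
rewrite -e; exists (tensrep rho r); split; first exact: tensrep_is_rep.
by rewrite tensrep_char -IH.
Qed.

End Representations.

(** * Trace functions and the character ring *)

(** Write the characteristic polynomial as X^k q with q(0) != 0. A Bezout relation u X^(k+1) + v q =
    1 makes g = u X^(k+1) idempotent modulo X^k q, so g(A) is idempotent by Cayley-Hamilton; if it
    vanishes, A is nilpotent. *)
Lemma fitting_mx (F : fieldType) n (A : 'M[F]_n) :
  (exists k, A ^+ k = 0) \/
  exists s : nat -> F, exists k, let E := \sum_(i < k) s i *: A ^+ i.+1 in E *m E = E /\ E != 0.
Proof.
case: n A => [|n] A; first by left; exists 0%N; apply/matrixP => -[].
have [k [q q0 Dp]] := multiplicity_XsubC (char_poly A) 0.
rewrite monic_neq0 ?char_poly_monic //= in q0; rewrite subr0 in Dp.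
(* The exponent k+1 instead of k leaves a factor X in [g], so that [E] has no constant term even
   when A is invertible. *)
have cop : coprimep 'X^(k.+1) q.
  by apply: coprimep_expl; rewrite coprimep_sym -['X]subr0 coprimep_XsubC.
have [[u v] /= uv] := Bezout_eq1_coprimepP _ _ cop.
pose h p := horner_mx A p.
have CH : h (q * 'X^k) = 0 by rewrite -Dp; apply: Cayley_Hamilton.
have hM p r : h (p * r) = h p * h r by rewrite /h rmorphM.
have hX i : h 'X^i = A ^+ i by rewrite /h rmorphXn /= horner_mx_X.
pose g := u * 'X^(k.+1).
have gg : g * g - g = (- u * v * 'X) * (q * 'X^k).
  have -> : g * g - g = - g * (1 - g) by ring.
  by rewrite -uv [X in X - g]addrC addrK /g exprS; ring.
have EE : h g *m h g = h g.
  apply/eqP; rewrite -subr_eq0; apply/eqP.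
  rewrite -[h g *m h g]/(h g * h g) -hM.
  have -> : h (g * g) - h g = h (g * g - g) by rewrite /h rmorphB.
  by rewrite gg hM CH mulr0.
have gE : h g = \sum_(i < size (u * 'X^k)) (u * 'X^k)`_i *: A ^+ i.+1.
  have -> : g = (u * 'X^k) * 'X by rewrite /g exprSr mulrA.
  rewrite -{1}[u * 'X^k]coefK poly_def mulr_suml /h raddf_sum; apply: eq_bigr => i _ /=.
  by rewrite -scalerAl -exprSr linearZ /= -/(h _) hX.
have [E0|nzE] := eqVneq (h g) 0; [left | right].
  exists k.+1; rewrite -hX -['X^_]mulr1 -uv mulrDr.
  have -> : h ('X^(k.+1) * (u * 'X^(k.+1)) + 'X^(k.+1) * (v * q)) =
      h ('X^(k.+1)) * h g + h ('X * v) * h (q * 'X^k).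
    by rewrite -!hM /h -rmorphD /=; congr (horner_mx A _); rewrite /g !exprS; ring.
  by rewrite E0 CH !mulr0 addr0.
by exists (fun i => (u * 'X^k)`_i), (size (u * 'X^k)); rewrite /= -gE.
Qed.

Section Fitting.
Variables (C : numClosedFieldType) (d : nat) (H : hopf_data C d).
Hypothesis hH : is_hopf H.
Local Notation "x ** y" := (mulH H x y) (at level 40, left associativity).

Lemma lmx_inj x y : lmx H x = lmx H y -> x = y.
Proof. by move=> e; rewrite -[x](mulH1 hH) -[y](mulH1 hH) -!lmxE e. Qed.

Lemma lmx_sum (I : finType) (f : I -> 'rV[C]_d) : lmx H (\sum_i f i) = \sum_i lmx H (f i).
Proof.
apply: (big_morph (lmx H)) => [x y|]; first by rewrite -[x]scale1r lmxP !scale1r.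
by have := lmxP H (-1) 0 0; rewrite scaler0 addr0 scaleN1r addNr.
Qed.

Lemma lmxZ c x : lmx H (c *: x) = c *: lmx H x.
Proof.
have := lmxP H c x 0; rewrite !addr0 => ->.
by have := lmx_sum (fun i : 'I_0 => 0); rewrite !big_ord0 => ->; rewrite addr0.
Qed.

Lemma lmx_iter y i x : lmx H (iter i (mulH H y) x) = lmx H x *m lmx H y ^+ i.
Proof.
elim: i => [|i IH] /=; first by rewrite expr0 mulmx1.
by rewrite (lmxM hH) IH exprSr mulmxA.
Qed.

(** [P] stands for a subalgebra that need not contain the unit, such as a corner f R(H) f; hence the
    demand for polynomials without constant term. *)
Lemma fitting (P : 'rV[C]_d -> Prop) y : P y ->
  (forall c x z, P x -> P z -> P (c *: x + z)) -> (forall x z, P x -> P z -> P (x ** z)) ->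
  (exists k, lmx H y ^+ k = 0) \/
  exists w, [/\ P w, (y ** w) ** (y ** w) = y ** w & y ** w != 0].
Proof.
move=> Py Plin PM; have [|[s [k [EE nzE]]]] := fitting_mx (lmx H y); [by left | right].
have P0 : P 0 by rewrite -(addNr y) -scaleN1r; apply: Plin.
have Psum (f : 'I_k -> 'rV_d) : (forall i, P (f i)) -> P (\sum_i f i).
  move=> Pf; elim/big_rec: _ => // i x _ Px; rewrite -[f i]scale1r; exact: Plin.
have PZ c x : P x -> P (c *: x) by move=> Px; rewrite -[_ *: _]addr0; apply: Plin.
have Pit i x : P x -> P (iter i (mulH H y) x) by move=> Px; elim: i => //= i; apply: PM.
pose e := \sum_(i < k) s i *: iter i (mulH H y) y.
have le : lmx H e = \sum_(i < k) s i *: lmx H y ^+ i.+1.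
  rewrite lmx_sum; apply: eq_bigr => i _; rewrite lmxZ lmx_iter exprS; by [].
have Pe : P e by apply: Psum => i; apply/PZ/Pit.
have ee : e ** e = e by apply: lmx_inj; rewrite (lmxM hH) le.
(* The powers of [y] are applied to [e] and not to the unit, which keeps the term i = 0 in [P]; then
   y w = e e = e. *)
exists (\sum_(i < k) s i *: iter i (mulH H y) e).
have -> : y ** (\sum_(i < k) s i *: iter i (mulH H y) e) = e.
  apply: lmx_inj; rewrite (lmxM hH) lmx_sum mulmx_suml.
  rewrite -[in RHS]ee (lmxM hH) {2}le mulmx_sumr; apply: eq_bigr => i _.
  by rewrite lmxZ lmx_iter -scalemxAl -scalemxAr -mulmxA -[_ *m lmx H y]exprSr.
split=> //; first by apply: Psum => i; apply/PZ/Pit.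
by apply: contra nzE => /eqP e0; rewrite -le e0 -[0](scale0r 0) lmxZ scale0r.
Qed.

Lemma tr_lmx_idem e : e ** e = e -> e != 0 -> \tr (lmx H e) != 0.
Proof.
move=> ee nze; rewrite mxtrace_idem -?(lmxM hH) ?ee // pnatr_eq0 mxrank_eq0.
by apply: contra nze => /eqP e0; rewrite -[e](mulH1 hH) -lmxE e0 mulmx0.
Qed.

End Fitting.

Section CharacterRing.
Variables (C : numClosedFieldType) (d : nat) (H : hopf_data C d) (l L : 'rV[C]_d) (RH : 'M[C]_d).
Hypotheses (hH : is_hopf H) (il : integralHdual H l) (iL : integralH H L)
  (lL : pairH l L = 1) (l1 : pairH l (hunit H) = d%:R) (ss : semisimpleH H)
  (hRH : is_RH H RH).
Implicit Types (a b x y h p q : 'rV[C]_d).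
Local Notation e_ := (ebas C).
Local Notation "x ** y" := (mulH H x y) (at level 40, left associativity).
Local Notation "p ## q" := (convH H p q) (at level 40, left associativity).
Local Notation pr := (@pairH C d).
Local Notation one := (hunit H).
Local Notation eps := (epsH H).
Local Notation t p := (pr p L).

Let hD := is_hopf_dual hH.
Let iLD := integral_dual iL.
Let ilD := dual_integral il.
Let LlD : pr L l = 1 := etrans (pairHC L l) lL.

Definition tracial p := forall x y, pr p (x ** y) = pr p (y ** x).

Lemma tracial_conv p q : tracial p -> tracial q -> tracial (p ## q).
Proof.
move=> tp tq x y; rewrite !pairH_conv.
have l1' z : lin (fun x => pr p x * z) by move=> c u v; rewrite pairHPr; ring.
have l2' z : lin (fun x => z * pr q x) by move=> c u v; rewrite pairHPr; ring.
rewrite !(sw_mul hH) // sw_exchange; apply: eq_sw => u v; apply: eq_sw => u' v'.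
by rewrite tp tq.
Qed.

(** For the converse, nondegeneracy gives p = l(z .), and z is central because both [p] and [l] are
    symmetric. As [l] is the regular character, p(x) is the trace of z x on the regular
    representation, which [trace_in_RH] covers. *)
Lemma RH_tracial p : (p <= RH)%MS <-> tracial p.
Proof.
split.
  pose W := (\bigcap_(a < d) \bigcap_(b < d) kermx (e_ a ** e_ b - e_ b ** e_ a)^T)%MS.
  have inW q : (q <= W)%MS <-> tracial q.
    have ker (a b : 'I_d) : (q <= kermx (e_ a ** e_ b - e_ b ** e_ a)^T)%MS =
        (pr q (e_ a ** e_ b) == pr q (e_ b ** e_ a)).
      have e : pr q (e_ a ** e_ b) - pr q (e_ b ** e_ a) = pr q (e_ a ** e_ b - e_ b ** e_ a).
        by rewrite -[in RHS]scaleN1r [in RHS]addrC pairHPr mulN1r addrC.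
      rewrite -subr_eq0 e pairH_mx.
      apply/sub_kermxP/eqP => [->|e']; first by rewrite mxE.
      by apply/matrixP => i j; rewrite !ord1 e' mxE.
    split=> [qW x y|tq].
      have ee (a b : 'I_d) : pr q (e_ a ** e_ b) = pr q (e_ b ** e_ a).
        by apply/eqP; rewrite -ker; move/sub_bigcapmxP/(_ a isT)/sub_bigcapmxP/(_ b isT): qW.
      have ll z : lin (fun x => pr q (x ** z)) by move=> c u v; rewrite mulHPl pairHPr.
      have lr z : lin (fun x => pr q (z ** x)) by move=> c u v; rewrite mulHPr pairHPr.
      rewrite (linE x (ll _)) [RHS](linE x (lr _)); apply: eq_bigr => a _; congr (_ * _).
      rewrite (linE y (lr _)) [RHS](linE y (ll _)); apply: eq_bigr => b _; congr (_ * _).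
      exact: ee.
    apply/sub_bigcapmxP => a _; apply/sub_bigcapmxP => b _; rewrite ker; apply/eqP; exact: tq.
  move=> pRH; apply/inW; apply: submx_trans pRH _; apply: (proj2 hRH) => chi.
  case=> n [rho [[_ hr _] ->]]; apply/inW => x y; exact: char_tr.
move=> tp; pose z := p *m invmx (gram H l).
have pz x : pr p x = pr l (z ** x).
  by rewrite gramE /z mulmxKV ?(gram_unit hH il iL lL) // pairH_mx.
have zc x : z ** x = x ** z.
  apply: (gram_inj hH il iL lL) => y; rewrite (mulHA hH z) -pz tp pz.
  by rewrite (mulHA hH x) [RHS](integral_sym hH il iL lL l1 ss) (mulHA hH z).
(* [lmx] reverses products, so it is the transposed matrices that form a left representation. *)
have -> : p = \row_k \tr ((lmx H z)^T *m (lmx H (e_ k))^T).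
  apply/rowP => k; rewrite mxE -trmx_mul mxtrace_tr -(lmxM hH) -pairH_ebas pz.
  exact: (integral_chireg hH il iL lL l1 ss).
apply: (trace_in_RH hRH) => [|k]; last by rewrite -!trmx_mul -!(lmxM hH) zc.
have rE x : rep (fun k => (lmx H (e_ k))^T) x = (lmx H x)^T.
  rewrite /rep {2}(row_sum_delta x) lmx_sum raddf_sum; apply: eq_bigr => k _ /=.
  by rewrite lmxZ linearZ.
apply: is_repP => [|x y].
  rewrite rE; apply/eqP; rewrite -trmx1; apply/eqP; congr trmx.
  by apply/row_matrixP => i; rewrite !rowE lmxE (mul1H hH) mulmx1.
by rewrite !rE (lmxM hH) trmx_mul.
Qed.

(** The coproduct of p in H^* is given by p(xy) = p_1(x) p_2(y), so trace functions are exactly the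
    cocommutative elements. *)
Lemma sw_dual_flip p G : tracial p ->
  sw (dualH H) G p = sw (dualH H) (fun u v => G v u) p.
Proof.
move=> tp; rewrite /sw exchange_big [RHS]exchange_big /=.
under eq_bigr => a _ do rewrite exchange_big.
rewrite exchange_big; under [RHS]eq_bigr => a _ do rewrite exchange_big.
apply: eq_bigr => a _; apply: eq_bigr => b _ /=; rewrite -!mulr_suml; congr (_ * _).
have pe u v : pr p (e_ u ** e_ v) = \sum_c p 0 c * hmul H u v c.
  by apply: eq_bigr => c _; rewrite mulH_ebas.
by rewrite -!pe.
Qed.

(** The element represents q -> <x q, L>. Both swap rules, used in H^* with its integral [L],
    rewrite the two products as sums over the coproduct of x, and these agree because x is
    cocommutative. *)
Lemma harp_central x h : tracial x -> harp H L x ** h = h ** harp H L x.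
Proof.
move=> tx; set z := harp H L x; apply: pairH_injr => p.
have zE q : pr q z = t (x ## q) by rewrite pairH_harp.
have tsym := conv_integral_sym hH il iL lL l1 ss.
have pM u v : pr p (u ** v) = sw (dualH H) (fun p1 p2 => pr p1 u * pr p2 v) p.
  rewrite -mulH_dual pairHC pairH_conv; apply: eq_sw => p1 p2.
  by rewrite ![pr p1 _]pairHC ![pr p2 _]pairHC.
have lh : lin (fun q => pr q h) by move=> c u v; rewrite pairHPl.
have := integral_swap_right hD p x iLD lh.
have := integral_swap_left hD x p iLD lh.
rewrite sw_dual_flip // => eL eR.
transitivity (sw (dualH H) (fun a1 a2 => pr L (mulH (dualH H) a1 x) * pr a2 h) p).
  by rewrite pM; apply: eq_sw => p1 p2; rewrite zE tsym pairHC convHE.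
transitivity (sw (dualH H) (fun b1 b2 => pr b1 h * pr L (mulH (dualH H) x b2)) p); last first.
  by rewrite pM; apply: eq_sw => p1 p2; rewrite zE [t _]pairHC convHE.
rewrite eR -eL; apply: eq_sw => u v; rewrite mulrC; congr (_ * _).
by rewrite -!convHE pairHC tsym pairHC.
Qed.

(** Apply the dichotomy to the central element z = L <- x. If z is nilpotent, so is each z h, hence
    l(z h) = Tr(z h) = 0 and z = 0. Otherwise some z w is a nonzero idempotent with w central, and
    its trace l(w z) equals <x b, L> for the trace function b = l(w .), which is zero by
    assumption. *)
Lemma tracial_nondeg x : tracial x -> (forall b, tracial b -> t (x ## b) = 0) -> x = 0.
Proof.
move=> tx x0; pose z := harp H L x.
have zE q : pr q z = t (x ## q) by rewrite pairH_harp.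
have zc h : z ** h = h ** z by exact: harp_central.
have lsym := integral_sym hH il iL lL l1 ss.
have ltr := integral_chireg hH il iL lL l1 ss.
have z0 : z = 0.
  case: (fitting hH (P := fun w => forall h, w ** h = h ** w) zc).
  - by move=> c u v hu hv h; rewrite mulHPl mulHPr hu hv.
  - by move=> u v hu hv h; rewrite (mulHA hH) hv -!(mulHA hH) -hu !(mulHA hH) hu.
  - case=> k zk; apply: (gram_inj hH il iL lL) => h.
    rewrite -[0](scale0r 0) -[_ *: _]addr0 mulHPl scale0r add0r ltr.
    have -> : pr l (mulH H 0 h) = 0.
      have e0 : mulH H 0 h = 0 by rewrite mulH_rmx mul0mx.
      by rewrite e0 pairH_mx trmx0 mulmx0 mxE.
    apply: (@mxtrace_nilp _ _ _ k); rewrite (lmxM hH).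
    rewrite -[_ *m _]/(lmx H h * lmx H z) exprMn_comm ?zk ?mulr0 //.
    by rewrite /GRing.comm -![_ * _]/(_ *m _) -!(lmxM hH) zc.
  - case=> w [wc ee nze]; exfalso; have := tr_lmx_idem hH ee nze.
    rewrite -ltr lsym gramE.
    have -> : (w *m gram H l *m z^T) 0 0 = pr (w *m gram H l) z by rewrite pairH_mx.
    rewrite zE x0 ?eqxx // => u v.
    have bE y : pr (w *m gram H l) y = pr l (w ** y) by rewrite gramE pairH_mx.
    by rewrite !bE -(mulHA hH w u) lsym -(mulHA hH v) -wc (mulHA hH w).
apply: (gram_inj hD iLD ilD LlD) => q; rewrite -!convHE [LHS]pairHC -zE z0.
by rewrite convHE mulH_rmx mul0mx !pairH_mx !trmx0 !mulmx0.
Qed.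

End CharacterRing.

(** * A block of the character ring *)

Section Block.
Variables (C : numClosedFieldType) (d : nat) (H : hopf_data C d) (l L : 'rV[C]_d)
  (RH : 'M[C]_d) (F f : 'rV[C]_d).
Hypotheses (hH : is_hopf H) (il : integralHdual H l) (iL : integralH H L)
  (lL : pairH l L = 1) (l1 : pairH l (hunit H) = d%:R) (ss : semisimpleH H)
  (hRH : is_RH H RH) (hF : central_prim_idem H RH F) (hf : prim_idem H RH f)
  (fF : convH H f F = f).
Implicit Types (b x y h p q u v : 'rV[C]_d).
Local Notation e_ := (ebas C).
Local Notation "p ## q" := (convH H p q) (at level 40, left associativity).
Local Notation pr := (@pairH C d).
Local Notation one := (hunit H).
Local Notation eps := (epsH H).
Local Notation t p := (pr p L).
Local Notation rconv p := (rmx (dualH H) p).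

Let hD := is_hopf_dual hH.

Lemma convHPl c p q r : (c *: p + q) ## r = c *: (p ## r) + q ## r.
Proof. by rewrite !convHE mulHPl. Qed.
Lemma convHPr c p q r : r ## (c *: p + q) = c *: (r ## p) + r ## q.
Proof. by rewrite !convHE mulHPr. Qed.
Lemma convHrE p q : p ## q = p *m rconv q.
Proof. by rewrite convHE mulH_rmx. Qed.
Lemma convBl p q r : (p - q) ## r = p ## r - q ## r.
Proof. by rewrite !convHrE mulmxBl. Qed.
Lemma convBr p q r : r ## (p - q) = r ## p - r ## q.
Proof. by rewrite !convH_lconv mulmxBl. Qed.
Lemma conv0l p : 0 ## p = 0. Proof. by rewrite convHrE mul0mx. Qed.
Lemma conv0r p : p ## 0 = 0. Proof. by rewrite convH_lconv mul0mx. Qed.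
Lemma conv_suml (I : finType) (g : I -> 'rV[C]_d) p :
  (\sum_i g i) ## p = \sum_i g i ## p.
Proof. by rewrite convHrE mulmx_suml; apply: eq_bigr => i _; rewrite convHrE. Qed.
Lemma conv_sumr (I : finType) (g : I -> 'rV[C]_d) p :
  p ## (\sum_i g i) = \sum_i p ## g i.
Proof. by rewrite convH_lconv mulmx_suml; apply: eq_bigr => i _; rewrite convH_lconv. Qed.

Let cA := convHA hH.
Let tr_sym := conv_integral_sym hH il iL lL l1 ss.
Let tracialE := RH_tracial hH il iL lL l1 ss hRH.

Lemma lconv_lmx p : lconv H p = lmx (dualH H) p.
Proof. by apply/row_matrixP => i; rewrite !rowE -convH_lconv convHE lmxE. Qed.

Lemma pairHZl c p x : pr (c *: p) x = c * pr p x.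
Proof. by rewrite !pairH_mx -scalemxAl mxE. Qed.

Lemma RH_conv p q : (p <= RH)%MS -> (q <= RH)%MS -> (p ## q <= RH)%MS.
Proof. by move=> /tracialE tp /tracialE tq; apply/tracialE/tracial_conv. Qed.

Lemma RH_nondeg x : (x <= RH)%MS -> (forall b, (b <= RH)%MS -> t (x ## b) = 0) -> x = 0.
Proof.
move=> /tracialE tx x0; apply: (tracial_nondeg hH il iL lL l1 ss tx) => b tb.
by apply: x0; apply/tracialE.
Qed.

Let fRH : (f <= RH)%MS. Proof. by case: hf. Qed.
Let ff : f ## f = f. Proof. by case: hf. Qed.
Let nzf : f != 0. Proof. by case: hf. Qed.

Lemma prim_idem_eq e : (e <= RH)%MS -> e ## e = e -> e != 0 ->
  f ## e = e -> e ## f = e -> e = f.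
Proof.
move=> eR ee nze fe ef; have [_ _ _ nex] := hf; apply/eqP; case: eqVneq => // nef.
exfalso; apply: nex; exists e, (f - e); split=> //.
- split=> //; rewrite addmx_sub // -scaleN1r scalemx_sub //.
- by rewrite /idemH convBl !convBr ff fe ef ee subrr subr0.
- split=> //; first by rewrite subr_eq0 eq_sym.
    by rewrite convBr ef ee subrr.
  by rewrite convBl fe ee subrr.
- by rewrite addrC subrK.
Qed.

Definition corner x := [/\ (x <= RH)%MS, f ## x = x & x ## f = x].

(* Fitting: z is nilpotent, as otherwise f = z w for some w, and u z = 0. *)
Lemma corner_trace0 z u : corner z -> u != 0 -> u ## f = u -> u ## z = 0 -> t z = 0.
Proof.
move=> cz nzu uf uz.
case: (fitting hD (P := corner) cz) => [c x y [xR fx xf] [yR fy yf]|x y [xR fx xf] [yR fy yf]||].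
- split; first by rewrite addmx_sub // scalemx_sub.
    by rewrite convHPr fx fy.
  by rewrite convHPl xf yf.
- rewrite -convHE; split; first exact: RH_conv.
    by rewrite -cA fx.
  by rewrite cA yf.
- case=> k zk; apply: (mulfI (d_neq0 lL)); rewrite mulr0.
  rewrite -(tr_lconv hH il iL lL l1 ss) lconv_lmx.
  exact: mxtrace_nilp zk.
- case=> w [[wR fw wf]]; rewrite -!convHE => ee nze.
  have [zR fz zf] := cz; have e : z ## w = f.
    apply: prim_idem_eq => //; first exact: RH_conv.
      by rewrite -cA fz.
    by rewrite cA wf.
  by case/negP: nzu; rewrite -uf -e -cA uz conv0l.
Qed.

(** The eigenvector is sought in the nonzero space H^* f, which right multiplication by [x]
    preserves. *)
Lemma corner_eigen x : corner x ->
  exists al u, [/\ u != 0, u ## f = u & u ## x = al *: u].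
Proof.
move=> [xR fx xf]; pose B := row_base (rconv f).
have Bf (y : 'rV_(\rank (rconv f))) : (y *m B) ## f = y *m B.
  have : (y *m B <= rconv f)%MS by rewrite (submx_trans (submxMl _ _)) // eq_row_base.
  by case/submxP => D ->; rewrite -convHrE cA ff.
have st : (B *m rconv x <= B)%MS.
  apply/row_subP => i; rewrite row_mul eq_row_base -convHrE -xf -cA convHrE.
  exact: submxMl.
have [Y eY] := submxP st.
have r0 : (0 < \rank (rconv f))%N.
  rewrite lt0n mxrank_eq0; apply: contra nzf => /eqP e.
  by rewrite -ff convHrE e mulmx0.
have [r [_ Dp]] := mxtrace_eigen Y.
have [w wY nzw] := char_poly_root_eigen Dp (Ordinal r0).
exists (r (Ordinal r0)), (w *m B); split=> //.
  apply: contra nzw => /eqP e; apply/eqP.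
  by apply: (row_free_inj (row_base_free (rconv f))); rewrite mul0mx; exact: e.
by rewrite convHrE -mulmxA eY mulmxA wY scalemxAl.
Qed.

(** For y = x - al f the eigenvector satisfies u y = 0. Then u also kills y (f b f) for every b in
    R(H), so <y b, L> = <y f b f, L> = 0 by [corner_trace0], and y = 0 by nondegeneracy. *)
Lemma corner_scalar x : corner x -> exists al, x = al *: f.
Proof.
move=> cx; have [al [u [nzu uf ux]]] := corner_eigen cx; have [xR fx xf] := cx.
exists al; apply/eqP; rewrite -subr_eq0; apply/eqP.
set y := x - _; have uy : u ## y = 0.
  by rewrite /y convBr ux (convZr H) uf subrr.
have yR : (y <= RH)%MS by rewrite addmx_sub // -scaleN1r !scalemx_sub.
have fy : f ## y = y by rewrite /y convBr fx (convZr H) ff.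
have yf : y ## f = y by rewrite /y convBl xf (convZl H) ff.
apply: RH_nondeg => // b bR.
have -> : t (y ## b) = t (y ## (f ## b ## f)).
  by rewrite -{1}fy cA tr_sym -!cA yf.
apply: (corner_trace0 _ nzu uf); last by rewrite -cA uy conv0l.
split; first by rewrite !RH_conv.
  by rewrite -cA fy.
by rewrite -!cA (cA _ f f) ff.
Qed.

(** The dimension of f H^* is the trace of an idempotent; this is the constant that normalises
    eta. *)
Lemma rank_lconv : (\rank (lconv H f))%:R = d%:R * t f.
Proof.
rewrite -(tr_lconv hH il iL lL l1 ss) mxtrace_idem //.
by rewrite -(lconvM hH) ff.
Qed.

Lemma rank_lconv_neq0 : (\rank (lconv H f))%:R != 0 :> C.
Proof.
rewrite pnatr_eq0 mxrank_eq0; apply: contra nzf => /eqP e.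
by rewrite -ff convH_lconv e mulmx0.
Qed.

Lemma trace_f_neq0 : t f != 0.
Proof. by have := rank_lconv_neq0; rewrite rank_lconv mulf_eq0 => /norP[]. Qed.

Local Notation fB := (RH *m lconv H f).
Local Notation Bf := (RH *m rconv f).
Local Notation m := (\rank fB).

Lemma sub_fB u : (u <= fB)%MS <-> (u <= RH)%MS /\ f ## u = u.
Proof.
split=> [/submxP[D ->]|[uR fu]].
  rewrite mulmxA -convH_lconv -cA ff; split=> //; apply: RH_conv => //.
  exact: submxMl.
by rewrite -fu convH_lconv submxMr.
Qed.

Lemma sub_Bf v : (v <= Bf)%MS <-> (v <= RH)%MS /\ v ## f = v.
Proof.
split=> [/submxP[D ->]|[uR fu]].
  rewrite mulmxA -convHrE cA ff; split=> //; apply: RH_conv => //.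
  exact: submxMl.
by rewrite -fu convHrE submxMr.
Qed.

(** The scalar c in u v = c f, for u in f R(H) and v in R(H) f. *)
Definition phi u v := t (u ## v) / t f.

Lemma conv_phi u v : (u <= fB)%MS -> (v <= Bf)%MS -> u ## v = phi u v *: f.
Proof.
move=> /sub_fB[uR fu] /sub_Bf[vR vf].
have [|al e] := @corner_scalar (u ## v).
  split; first exact: RH_conv.
    by rewrite -cA fu.
  by rewrite cA vf.
by rewrite /phi e [t _]pairHC (linZ _ _ (linpair L)) pairHC mulfK // trace_f_neq0.
Qed.

Lemma phiPr c v v' u : phi u (c *: v + v') = c * phi u v + phi u v'.
Proof. by rewrite /phi convHPr pairHPl mulrDl mulrA. Qed.

Local Notation U := (row_base fB).

Lemma rowU_fB k : (row k U <= fB)%MS.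
Proof. by rewrite (submx_trans (row_sub _ _)) // eq_row_base. Qed.

(** For u in f R(H), <u b, L> = <u (b f), L> depends only on b f, so nondegeneracy on R(H) passes to
    the pairing of f R(H) with R(H) f. *)
Lemma dual_basis : exists V : 'M[C]_(m, d), (forall k, (row k V <= Bf)%MS) /\
  forall k j, phi (row k U) (row j V) = (k == j)%:R.
Proof.
pose G := gram (dualH H) L.
have gE u v : t (u ## v) = (u *m G *m v^T) 0 0 by rewrite convHE pairHC gramE.
pose W := row_base Bf; pose Pm := U *m G *m W^T.
have fr : row_free Pm.
  rewrite -kermx_eq0; apply/rowV0P => a /sub_kermxP aP.
  have auB : (a *m U <= fB)%MS by rewrite (submx_trans (submxMl _ _)) // eq_row_base.
  have [auR fau] := proj1 (sub_fB _) auB.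
  have : a *m U = 0.
    apply: RH_nondeg => // b bR.
    have : (b ## f <= W)%MS by rewrite eq_row_base convHrE submxMr.
    case/submxP => D e; rewrite -fau tr_sym -cA tr_sym e gE trmx_mul mulmxA.
    by rewrite -(mulmxA a) -(mulmxA a) aP mul0mx mxE.
  by move=> e; apply: (row_free_inj (row_base_free fB)); rewrite mul0mx; exact: e.
have [Q PQ] := row_freeP fr.
(* The factor [t f] cancels the division in [phi]. *)
exists (t f *: (Q^T *m W)); split=> [k|k j].
  by rewrite (submx_trans (row_sub _ _)) // scalemx_sub // (submx_trans (submxMl _ _)) // eq_row_base.
have e : U *m G *m (Q^T *m W)^T = 1%:M by rewrite trmx_mul trmxK mulmxA PQ.
rewrite /phi linearZ /= (convZr H) pairHZl mulrC mulKf ?trace_f_neq0 // gE.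
rewrite -row_mul tr_row.
have <- : (U *m G *m (Q^T *m W)^T) k j = (k == j)%:R by rewrite e mxE.
by rewrite [RHS]mxE !mxE; apply: eq_bigr => i _; rewrite !mxE.
Qed.

(** [R] is the matrix of r_chi on f R(H). In the second conclusion q = v_j u_k does not depend on n,
    so a bound on the characters chi^n bounds all powers of [R]. *)
Lemma block_trace chi (R : 'M[C]_m) : (chi <= RH)%MS -> U *m rconv chi = R *m U ->
  t (F ## chi) = t f * \tr R /\
  forall k j, exists q, forall n,
    (R ^+ n) k j = t (q ## iter n (convH H chi) eps) / t f.
Proof.
move=> chiR UR; have [V [VB UV]] := dual_basis.
pose u k := row k U; pose v k := row k V.
have uB k : (u k <= fB)%MS := rowU_fB k.
have uR k : (u k <= RH)%MS by have [] := proj1 (sub_fB _) (uB k).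
have fu k : f ## u k = u k by have [] := proj1 (sub_fB _) (uB k).
have vR k : (v k <= RH)%MS by have [] := proj1 (sub_Bf _) (VB k).
have vf k : v k ## f = v k by have [] := proj1 (sub_Bf _) (VB k).
have phiUl (a : 'rV[C]_m) j : phi (a *m U) (v j) = a 0 j.
  have -> : phi (a *m U) (v j) = \sum_k a 0 k * phi (u k) (v j).
    rewrite mulmx_sum_row /phi conv_suml /pairH.
    rewrite -/(pairH _ _) [t _]pairHC (lin_sum _ (linpair L)) mulr_suml.
    apply: eq_bigr => k _.
    by rewrite (convZl H) (linZ _ _ (linpair L)) [pr L _]pairHC mulrA.
  rewrite (bigD1 j) //= UV eqxx mulr1 big1 ?addr0 // => k kj.
  by rewrite UV (negbTE kj) mulr0.
have expU x : (x <= fB)%MS -> x = \sum_k phi x (v k) *: u k.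
  rewrite -(eq_row_base fB) => /submxP[a ->]; rewrite [LHS]mulmx_sum_row.
  by apply: eq_bigr => k _; rewrite phiUl.
have expV y : (y <= Bf)%MS -> y = \sum_k phi (u k) y *: v k.
  move=> yB; apply/eqP; rewrite -subr_eq0; apply/eqP; set z := y - _.
  have [yR yf] := proj1 (sub_Bf _) yB.
  have zB : (z <= Bf)%MS.
    rewrite addmx_sub // -scaleN1r scalemx_sub //; apply: summx_sub => k _.
    exact: scalemx_sub (VB k).
  have [zR zf] := proj1 (sub_Bf _) zB.
  have pz k : phi (u k) z = 0.
    rewrite /z -scaleN1r addrC phiPr mulN1r addrC; apply/eqP; rewrite subr_eq0; apply/eqP.
    have -> : phi (u k) (\sum_j phi (u j) y *: v j) = \sum_j phi (u j) y * phi (u k) (v j).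
      rewrite /phi conv_sumr [t _]pairHC (lin_sum _ (linpair L)) mulr_suml.
      apply: eq_bigr => j _.
      by rewrite (convZr H) (linZ _ _ (linpair L)) [pr L _]pairHC -!mulrA.
    rewrite (bigD1 k) //= UV eqxx mulr1 big1 ?addr0 // => j jk.
    by rewrite UV eq_sym (negbTE jk) mulr0.
  (* <z b, L> = <(f b) z, L>, where f b is a combination of the u_k and each u_k z vanishes. *)
  apply: RH_nondeg => // b bR; rewrite -zf cA tr_sym.
  have fbB : (f ## b <= fB)%MS.
    apply/sub_fB; split; first exact: RH_conv.
    by rewrite -cA ff.
  rewrite (expU _ fbB) conv_suml [t _]pairHC (lin_sum _ (linpair L)); apply: big1 => k _.
  rewrite (convZl H) (linZ _ _ (linpair L)) (conv_phi (uB k) zB) pz scale0r.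
  by rewrite -(scale0r 0) (linZ _ _ (linpair L)) mul0r mulr0.
pose E := \sum_k v k ## u k.
have ER : (E <= RH)%MS by apply: summx_sub => k _; apply: RH_conv.
have uE x : (x <= fB)%MS -> x ## E = x.
  move=> xB; rewrite {2}(expU _ xB) conv_sumr; apply: eq_bigr => k _.
  by rewrite -cA (conv_phi xB (VB k)) (convZl H) fu.
have EE : E ## E = E.
  rewrite {1}/E conv_suml; apply: eq_bigr => k _.
  by rewrite cA uE.
(* Expanding u_k b in the basis u and b v_k in the basis v gives the same double sum, since phi(u_k
   b, v_j) = phi(u_k, b v_j). *)
have Ec b : (b <= RH)%MS -> E ## b = b ## E.
  move=> bR; rewrite conv_suml conv_sumr.
  transitivity (\sum_k \sum_j phi (u k ## b) (v j) *: (v k ## u j)).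
    apply: eq_bigr => k _; rewrite cA.
    have ub : (u k ## b <= fB)%MS.
      apply/sub_fB; split; first exact: RH_conv.
      by rewrite -cA fu.
    rewrite {1}(expU _ ub) conv_sumr; apply: eq_bigr => j _; by rewrite (convZr H).
  rewrite exchange_big; apply: eq_bigr => k _ /=; rewrite -cA.
  have bv : (b ## v k <= Bf)%MS.
    apply/sub_Bf; split; first exact: RH_conv.
    by rewrite cA vf.
  rewrite {1}(expV _ bv) conv_suml; apply: eq_bigr => j _; rewrite (convZl H).
  by rewrite /phi cA.
have [FR FF nzF Fc Fprim] := hF.
have EF : E ## F = E.
  rewrite /E conv_suml; apply: eq_bigr => k _.
  have uF : u k ## F = u k by rewrite -{1}(fu k) cA -Fc // -cA fF fu.
  by rewrite cA uF.
have fE : f ## E = f by apply: uE; apply/sub_fB.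
have nzE : E != 0 by apply: contra nzf => /eqP E0; rewrite -fE E0 conv0r.
(* Otherwise F = E + (F - E) would split F into nonzero orthogonal central idempotents. *)
have eEF : E = F.
  apply/eqP; rewrite eq_sym; case: eqVneq => // nFE; exfalso; apply: Fprim.
  have FE : F ## E = E by rewrite -Ec.
  exists E, (F - E); split=> //.
  - split=> //; rewrite addmx_sub // -scaleN1r scalemx_sub //.
  - by rewrite /idemH convBl !convBr FF FE EF EE subrr subr0.
  - split=> //; first by move=> x xR; rewrite convBl convBr Fc // Ec.
      by rewrite subr_eq0.
    by rewrite convBr EF EE subrr.
  - by rewrite addrC subrK.
have Rrow n k : u k *m rconv chi ^+ n = row k (R ^+ n) *m U.
  have UR' : U *m rconv chi ^+ n = R ^+ n *m U.
    elim: n => [|n IH]; first by rewrite !expr0 mulmx1 mul1mx.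
    by rewrite [in LHS]exprSr mulmxA IH -mulmxA UR mulmxA [in RHS]exprSr.
  by rewrite /u -!row_mul UR'.
have pow n x : x *m rconv chi ^+ n = x ## iter n (convH H chi) eps.
  elim: n x => [|n IH] x; first by rewrite expr0 mulmx1 /= (convH1 hH).
  by rewrite exprS mulmxA -convHrE IH cA.
have Rn n k j : (R ^+ n) k j = t ((v j ## u k) ## iter n (convH H chi) eps) / t f.
  rewrite cA tr_sym -/(phi _ _) -pow Rrow phiUl; by rewrite mxE.
split; last by move=> k j; exists (v j ## u k) => n.
rewrite -eEF /E conv_suml [t _]pairHC (lin_sum _ (linpair L)) mulr_sumr; apply: eq_bigr => k _.
have := Rn 1%N k k; rewrite expr1 /= (convH1 hH) => ->.
by rewrite mulrC divfK ?trace_f_neq0 // pairHC.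
Qed.

End Block.

(** * The bound for the generalized character table *)

Lemma CC_archi (x : CC) : exists n : nat, `|x| < n%:R.
Proof.
case: x => a b; rewrite normc_def; set s := Num.sqrt _.
exists (Num.bound s); rewrite -(rmorph_nat (real_complex Rdefinitions.R)) ltcR.
exact: archi_boundP (sqrtr_ge0 _).
Qed.

Unset Implicit Arguments.
Set Strict Implicit.

(* chi = chi_i (an irreducible character), F = F_j, f = f_j, RH spans R(H),
   Lam = Lambda, lam = lambda (F_0 = lam / d).
   m_j = dim f_j R(H) = \rank (RH *m lconv f);  dim (f_j H^* ) = \rank (lconv f);
   eta_j = 1/dim(f_j H^* ) (Lam <- d F_j);  r_chi x = x chi on f_j R(H). *)
Theorem theorem2p8 (d : nat) (H : hopf_data CC d)
    (Lam lam chi F f : 'rV[CC]_d) (RH : 'M[CC]_d) :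
  is_hopf H -> semisimpleH H ->
  integralH H Lam -> integralHdual H lam -> pairH lam Lam = 1 ->
  idemH H (d%:R^-1 *: lam) ->
  is_RH H RH -> irr_char H chi ->
  central_prim_idem H RH F -> prim_idem H RH f -> convH H f F = f ->
  let m := \rank (RH *m lconv H f) in
  let eta := (\rank (lconv H f))%:R^-1 *: harp H Lam (d%:R *: F) in
  let chi1 := pairH chi (hunit H) in
  let fRH := RH *m lconv H f in
  [/\ `|pairH chi eta| <= m%:R * chi1,
      `|pairH chi eta| = m%:R * chi1 <->
        (exists alpha : CC, `|alpha| = chi1 /\
           forall x, (x <= fRH)%MS -> convH H x chi = alpha *: x)
    & pairH chi eta = m%:R * chi1 <->
        (forall x, (x <= fRH)%MS -> convH H x chi = chi1 *: x)].
Proof.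
move=> hH ss iL il lL lidem hRH irr hF hf fF m eta chi1 fRH.
have nd := d_neq0 lL.
(* Since lam lam = <lam, 1> lam, idempotence of lam / d forces <lam, 1> = d. *)
have l1 : pairH lam (hunit H) = d%:R.
  have nzl : lam != 0.
    apply/eqP => l0; have := oner_neq0 CC.
    by rewrite -lL l0 pairH_mx mul0mx mxE eqxx.
  move: lidem; rewrite /idemH convZl convZr (proj1 (il _)) !scalerA => /eqP.
  rewrite -subr_eq0 -scalerBl scaler_eq0 (negbTE nzl) orbF subr_eq0 => /eqP e.
  apply: (mulfI (mulf_neq0 (invr_neq0 nd) (invr_neq0 nd))).
  by rewrite e -mulrA mulVf ?mulr1.
have [n [rho [[n0 hr _] Dchi]]] := irr.
have chiR : (chi <= RH)%MS by apply: (proj1 hRH).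
have chi1E : chi1 = n%:R by rewrite /chi1 Dchi pairH_char (rep1 hr) mxtrace1.
have chi1_gt0 : 0 < chi1 by rewrite chi1E ltr0n.
have [fR ff nzf _] := hf.
have subf x : (x <= fRH)%MS <-> (x <= RH)%MS /\ convH H f x = x.
  exact: (sub_fB hH il iL lL l1 ss hRH hf).
have st : (row_base fRH *m rmx (dualH H) chi <= row_base fRH)%MS.
  apply/row_subP => i; rewrite row_mul eq_row_base -convHrE.
  have /subf[uR fu] : (row i (row_base fRH) <= fRH)%MS.
    by rewrite (submx_trans (row_sub _ _)) // eq_row_base.
  apply/subf; split; first exact: (RH_conv hH il iL lL l1 ss hRH).
  by rewrite -(convHA hH) fu.
have [R UR] := submxP st.
have [tR Rpow] := block_trace hH il iL lL l1 ss hRH hF hf fF chiR UR.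
have nzt := trace_f_neq0 hH il iL lL l1 ss hf.
(* <chi, eta> = d <F chi, Lam> / (d <f, Lam>), and [block_trace] evaluates the numerator. *)
have etaE : pairH chi eta = \tr R.
  rewrite /eta (linZ _ _ (linpair chi)) pairH_harp convZl pairHZl tR.
  rewrite (rank_lconv hH il iL lL l1 ss hf).
  by rewrite [X in _ * X]mulrA mulKf // mulf_neq0.
have m0 : (0 < m)%N.
  rewrite lt0n mxrank_eq0; apply: contra nzf => /eqP e.
  by have : (f <= fRH)%MS; [apply/subf | rewrite /fRH e submx0].
have [K K0 hK] := rep_bound H.
(* The entries of R^k are fixed linear functionals of chi^k, whose coordinates are values at basis
   elements of a character of degree chi1^k, hence at most chi1^k K. *)
have [B bR] : exists B, forall k i j, `|(R ^+ k) i j| <= B * chi1 ^+ k.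
  have ex (ij : 'I_m * 'I_m) : exists c, 0 <= c /\ forall k, `|(R ^+ k) ij.1 ij.2| <= c * chi1 ^+ k.
    have [q hq] := Rpow ij.1 ij.2.
    exists (\sum_j `|pairH (convH H q (ebas CC j)) Lam| * K / `|pairH f Lam|); split=> [|k].
      by apply: sumr_ge0 => j _; rewrite !mulr_ge0 ?invr_ge0.
    rewrite hq; set p := iter _ _ _; rewrite normrM normfV mulr_suml.
    have -> : pairH (convH H q p) Lam = \sum_j p 0 j * pairH (convH H q (ebas CC j)) Lam.
      by apply: (linE (g := fun p => pairH (convH H q p) Lam)) => c x y; rewrite convHPr pairHPl.
    apply: (le_trans (ler_wpM2r _ (ler_norm_sum _ _ _))); first by rewrite invr_ge0.
    rewrite mulr_suml; apply: ler_sum => j _.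
    have [r [hr' pE]] := conv_pow_char hH k hr.
    have bj : `|p 0 j| <= chi1 ^+ k * K.
      by have := hK _ r hr' j; rewrite chi1E -natrX /p Dchi pE mxE.
    rewrite normrM -mulrA [leRHS](_ : _ = chi1 ^+ k * K *
      (`|pairH (convH H q (ebas CC j)) Lam| / `|pairH f Lam|)); last by ring.
    by rewrite ler_wpM2r // divr_ge0.
  have [c hc] := fin_all_exists ex.
  exists (\sum_ij c ij) => k i j; apply: (le_trans (proj2 (hc (i, j)) k)).
  apply: ler_wpM2r; first by rewrite exprn_ge0 // ltW.
  rewrite (bigD1 (i, j)) //= lerDl.
  by apply: sumr_ge0 => ij _; case: (hc ij).
have [le_tr eq_tr] := power_bounded_trace CC_archi chi1_gt0 bR.
have act (a : CC) : R = a%:M -> forall x, (x <= fRH)%MS -> convH H x chi = a *: x.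
  move=> Ra x; rewrite -(eq_row_base fRH) => /submxP[y ->].
  by rewrite convHrE -mulmxA UR Ra mul_scalar_mx -scalemxAr.
have scal (a : CC) : (forall x, (x <= fRH)%MS -> convH H x chi = a *: x) -> R = a%:M.
  move=> ax; apply: (row_free_inj (row_base_free fRH)).
  change (R *m row_base fRH = a%:M *m row_base fRH).
  rewrite -UR mul_scalar_mx; apply/row_matrixP => i; rewrite row_mul -convHrE ax; last first.
    by rewrite (submx_trans (row_sub _ _)) // eq_row_base.
  by apply/rowP => j; rewrite !mxE.
rewrite etaE; split=> //.
- split=> [/eq_tr[a na Ra]|[a [na ax]]]; first by exists a; split=> //; apply: act.
  by rewrite (scal a ax) mxtrace_scalar normrMn na mulr_natl.
- split=> [e|ax]; last by rewrite (scal _ ax) mxtrace_scalar mulr_natl.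
  have ge0 : 0 <= m%:R * chi1 by rewrite mulr_ge0 // ltW.
  have [|a na Ra] := eq_tr; first by rewrite e ger0_norm.
  (* Comparing traces, m a = m chi1 with m > 0 determines the scalar. *)
  apply: act; rewrite Ra; congr (_%:M); apply: (mulfI (x := m%:R)).
    by rewrite pnatr_eq0 -lt0n.
  by rewrite -e Ra mxtrace_scalar mulr_natl.
Qed.
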